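(* Let $Q$ be a countable amenable (discrete) group, let $P$ be a subsemigroup of $Q$ (i.e. $P\subset Q$, $PP\subset P$, $e\in P$), and let $(X,P,T)$ be a directed locally compact semigroup action. Then the semidirect product groupoid $G(X,P,T)$ is topologically amenable.
   Context: A right (partial) action of a semigroup $P$ with identity $e$ on a set $X$ consists of a subset $X*P\subset X\times P$ and a map $X*P\to X$, $(x,m)\mapsto x\cdot m$, such that (i) $(x,e)\in X*P$ and $x\cdot e=x$ for all $x$; (ii) for all $x\in X$, $m,n\in P$: $(x,mn)\in X*P$ iff $(x,m)\in X*P$ and $(x\cdot m,n)\in X*P$, and then $(x\cdot m)\cdot n=x\cdot(mn)$. Put $U(m)=\{x:(x,m)\in X*P\}$, $V(m)=\{x\cdot m:(x,m)\in X*P\}$, $T_m:U(m)\to V(m)$, $T_mx=x\cdot m$. Write $m\le n$ in $P$ if $n=mp$ for some $p\in P$. The action is directed if whenever $U(m)\cap U(n)\neq\emptyset$ there is $r\in P$ with $m\le r$, $n\le r$ and $U(m)\cap U(n)=U(r)$. It is locally compact if $X$ is a locally compact Hausdorff space (second countable, per the paper's standing convention), $Q$ is discrete, and each $U(m),V(m)$ is open with $T_m:U(m)\to V(m)$ a local homeomorphism. The semidirect product groupoid $G(X,P,T)$ is the set of $(x,q,y)\in X\times Q\times X$ such that there are $m,n\in P$ with $q=mn^{-1}$, $x\in U(m)$, $y\in U(n)$, $x\cdot m=y\cdot n$; it is a groupoid with $(x,q,y)(y,q',z)=(x,qq',z)$, $(x,q,y)^{-1}=(y,q^{-1},x)$,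 unit space $X$ (via $x\mapsto(x,e,x)$), and topology with basis the sets $Z(U,m,n,V)=\{(x,mn^{-1},y): x\in U, y\in V, x\cdot m=y\cdot n\}$, $U,V\subset X$ open, $m,n\in P$. *)

(* Defs.v *)
From HB Require Import structures.
From mathcomp Require Import all_boot all_order all_algebra.
From mathcomp Require Import all_classical all_reals all_analysis.
From mathcomp Require Import Rstruct Rstruct_topology.
Set Implicit Arguments. Unset Strict Implicit. Unset Printing Implicit Defensive.
Import Order.TTheory GRing.Theory Num.Theory.
Local Open Scope classical_set_scope.
Local Open Scope ring_scope.

Notation R := Rdefinitions.R.

Definition is_group (Q : Type) (mul : Q -> Q -> Q) (inv : Q -> Q) (e : Q) : Prop :=
  [/\ forall a b c, mul a (mul b c) = mul (mul a b) c,
      forall a, mul e a = a /\ mul a e = a &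
      forall a, mul (inv a) a = e /\ mul a (inv a) = e].

Definition amenable_group (Q : Type) (mul : Q -> Q -> Q) : Prop :=
  exists mu : set Q -> R,
    [/\ mu setT = 1,
        forall A, 0 <= mu A,
        forall A B, A `&` B = set0 -> mu (A `|` B) = mu A + mu B &
        forall g A, mu [set mul g a | a in A] = mu A].

Definition subsemigroup (Q : Type) (mul : Q -> Q -> Q) (e : Q) (P : set Q) : Prop :=
  P e /\ forall m n, P m -> P n -> P (mul m n).

Section Action.
Context (X : topologicalType) (Q : choiceType) (mul : Q -> Q -> Q) (inv : Q -> Q) (e : Q)
        (P : set Q).
(* the partial action: [dom] is X*P (as a relation), [act x m] = x.m on dom *)
Context (dom : X -> Q -> Prop) (act : X -> Q -> X).

Definition Udom (m : Q) : set X := [set x | dom x m].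
Definition Vran (m : Q) : set X := [set act x m | x in Udom m].

Definition right_partial_action : Prop :=
  [/\ forall x m, dom x m -> P m,
      forall x, dom x e /\ act x e = x &
      forall x m n, P m -> P n ->
        (dom x (mul m n) <-> (dom x m /\ dom (act x m) n)) /\
        (dom x (mul m n) -> act (act x m) n = act x (mul m n))].

Definition Ple (m n : Q) : Prop := exists2 p, P p & n = mul m p.

Definition directed_action : Prop :=
  forall m n, P m -> P n -> Udom m `&` Udom n !=set0 ->
    exists r, [/\ P r, Ple m r, Ple n r & Udom m `&` Udom n = Udom r].

Definition local_homeo_on (U : set X) (f : X -> X) : Prop :=
  forall x, U x -> exists W : set X,
    [/\ open W /\ W x, W `<=` U,
        (forall a b, W a -> W b -> f a = f b -> a = b),
        {within W, continuous f} &
        forall O, open O -> O `<=` W -> open (f @` O)].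

Definition locally_compact_action : Prop :=
  [/\ hausdorff_space X, locally_compact [set: X], @second_countable X &
      forall m, P m ->
        [/\ open (Udom m), open (Vran m) & local_homeo_on (Udom m) (act^~ m)]].

Definition Gset : set (X * Q * X) :=
  [set g | exists m n, [/\ P m /\ P n, g.1.2 = mul m (inv n),
             dom g.1.1 m, dom g.2 n & act g.1.1 m = act g.2 n]].

Definition Zbasic (U : set X) (m n : Q) (V : set X) : set (X * Q * X) :=
  [set g | [/\ g.1.2 = mul m (inv n), U g.1.1 /\ V g.2, dom g.1.1 m, dom g.2 n
             & act g.1.1 m = act g.2 n]].

Definition Gopen (A : set (X * Q * X)) : Prop :=
  forall g, A g -> exists U m n V,
    [/\ open U /\ open V, P m, P n, Zbasic U m n V g & Zbasic U m n V `<=` A].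

Definition Gcompact (K : set (X * Q * X)) : Prop :=
  K `<=` Gset /\
  forall (J : Type) (O : J -> set (X * Q * X)), (forall j, Gopen (O j)) ->
    K `<=` \bigcup_j O j -> exists2 F : set J, finite_set F & K `<=` \bigcup_(j in F) O j.

Definition Gcontinuous (f : X * Q * X -> R) : Prop :=
  forall W : set R, open W -> Gopen [set g | Gset g /\ W (f g)].

Definition Gcc (f : X * Q * X -> R) : Prop :=
  Gcontinuous f /\ exists2 K, Gcompact K & forall g, Gset g -> ~ K g -> f g = 0.

Definition range_map (g : X * Q * X) : X := g.1.1.
Definition source_map (g : X * Q * X) : X := g.2.
Definition Gmul (g h : X * Q * X) : X * Q * X := (g.1.1, mul g.1.2 h.1.2, h.2).
Definition Ginv (g : X * Q * X) : X * Q * X := (g.2, inv g.1.2, g.1.1).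

Definition fiber (x : X) : set (X * Q * X) := [set g | Gset g /\ range_map g = x].

Definition fiber_sum (x : X) (f : X * Q * X -> R) : R :=
  fine (\esum_(g in fiber x) ((Num.max (f g) 0)%:E))%E -
  fine (\esum_(g in fiber x) ((Num.max (- f g) 0)%:E))%E.

(* Topological amenability (Anantharaman-Delaroche--Renault, Def. 2.2.8),
   for the etale groupoid G(X,P,T) equipped with the counting-measure Haar
   system: each probability measure m_i^x on the (countable, discrete) fiber
   G^x is given by its density m_i restricted to G^x. A topological
   approximate invariant mean is a net (m_i) of continuous systems of
   probability measures with || g m_i^{s(g)} - m_i^{r(g)} ||_1 -> 0
   uniformly on compact subsets of G. *)
Definition topologically_amenable : Prop :=
  exists (I : Type) (le : I -> I -> Prop) (m : I -> X * Q * X -> R),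
  [/\ (exists i : I, True) /\ (forall i, le i i),
      (forall i j k, le i j -> le j k -> le i k) /\
      (forall i j, exists k, le i k /\ le j k),
      (forall i g, Gset g -> 0 <= m i g) /\
      (forall i x, (\esum_(g in fiber x) (m i g)%:E = 1)%E),
      (forall i f, Gcc f ->
         {within [set: X], continuous (fun x => fiber_sum x (fun g => m i g * f g))}) &
      (forall K, Gcompact K -> forall eps : R, 0 < eps ->
         exists i0, forall i, le i0 i -> forall g, K g ->
           (\esum_(h in fiber (range_map g))
               (`|m i (Gmul (Ginv g) h) - m i h|)%:E < eps%:E)%E)].

End Action.

(* Main.v *)
(* Put Y = X * Q with Q discrete and let S_k (x, a) = x.(a^-1 k), defined on the
   open set D_k of those (x, a) with x in U(a^-1 k).  Two points of Y are
   equivalent for the skew product of G by its cocycle (x, q, y) |-> q exactly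
   when some S_k identifies them, and directedness makes the relations
   "S_k y = S_k z" a directed family, each of them proper on compact pieces.
   The D_k are not closed, so a mean along the fibres of S_k cannot simply be
   extended outside D_k; it is cut off by a bump function that varies slowly
   along the finitely many compact pieces of relations under consideration.
   Nesting such cut-offs yields a continuous kernel on Y, a finite combination
   of point masses moving along continuous sections of the S_k, that is
   approximately invariant on any given compact set.  Averaging it over a Folner
   set of Q gives an approximate invariant mean for G.  Folner sets are obtained
   from the invariant mean on Q by Tarski's argument: if every finite set were
   expanded by a fixed factor, Hall's theorem would produce an injective
   two-to-one duplication of Q by finitely many translations. *)
Require Import Defs.
From mathcomp Require Import all_boot all_order all_algebra finmap.
From mathcomp Require Import all_classical all_reals all_analysis.
From mathcomp Require Import Rstruct Rstruct_topology.
From mathcomp Require Import zify ring lra.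
Set Implicit Arguments. Unset Strict Implicit. Unset Printing Implicit Defensive.
Import Order.TTheory GRing.Theory Num.Theory.
Import numFieldNormedType.Exports.
Local Open Scope classical_set_scope.
Local Open Scope ring_scope.

(** * Hall's theorem and Folner sets *)

Section Hall.
Context (I T : choiceType).

Lemma fbigcupP (J : {fset I}) (A : I -> {fset T}) (x : T) :
  reflect (exists2 i, i \in J & x \in A i) (x \in (\bigcup_(i <- J) A i)%fset).
Proof.
apply: (iffP (bigfcupP _ _ _ _)) => -[i iJ xi]; exists i => //.
  by move: iJ; rewrite andbT.
by rewrite andbT.
Qed.

Definition hall_condition (A : I -> {fset T}) : Prop :=
  forall J : {fset I}, (#|` J| <= #|` (\bigcup_(i <- J) A i)%fset|)%N.

Definition remove_at (A : I -> {fset T}) (i : I) (x : T) (j : I) : {fset T} :=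
  if j == i then (A i `\ x)%fset else A j.

(** A set violating Hall's condition for the reduced family must contain [i], since the family is
    unchanged elsewhere; [J] is that set without [i]. *)
Lemma remove_at_unhall (A : I -> {fset T}) (i : I) (x : T) :
  hall_condition A -> ~ hall_condition (remove_at A i x) ->
  exists2 J : {fset I}, i \notin J &
    (#|` (A i `\ x) `|` \bigcup_(j <- J) A j| <= #|` J|)%fset%N.
Proof.
move=> hA /existsNP[J /negP]; rewrite -ltnNge => ltJ.
have [iJ|iJ] := boolP (i \in J); last first.
  move: ltJ; rewrite (eq_big_seq A) ?ltnNge ?hA// => j jJ.
  by rewrite /remove_at; case: eqP => // ji; rewrite -ji jJ in iJ.
exists (J `\ i)%fset; first by rewrite in_fsetD1 eqxx.
have cJ : #|` J| = #|` (J `\ i)%fset|.+1 by rewrite (cardfsD1 i J) iJ.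
move: ltJ; rewrite cJ ltnS; apply: leq_trans.
apply/fsubset_leq_card/fsubsetP => y; rewrite in_fsetU => /orP[yi|].
  by apply/fbigcupP; exists i; rewrite ?iJ// /remove_at eqxx.
move=> /fbigcupP[j]; rewrite in_fsetD1 => /andP[ji jJ] yj.
by apply/fbigcupP; exists j; rewrite ?jJ// /remove_at (negbTE ji).
Qed.

(** Submodularity of cardinality. If both removals failed, with witnesses [J] and [L], the sets [B]
    and [C] would satisfy |B| + |C| <= |J| + |L|. Since [x != y], the union of [B] and [C] contains
    all choices of [i], [J] and [L], and their intersection contains those of [J] and [L] in common,
    so Hall's condition gives |B| + |C| >= |J| + |L| + 1. *)
Lemma hall_remove (A : I -> {fset T}) (i : I) (x y : T) :
  hall_condition A -> x != y -> x \in A i -> y \in A i ->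
  hall_condition (remove_at A i x) \/ hall_condition (remove_at A i y).
Proof.
move=> hA xy xi yi; apply/or_asboolP/negPn/negP.
rewrite negb_or => /andP[/asboolPn/(remove_at_unhall hA)[J iJ cJ]].
move=> /asboolPn/(remove_at_unhall hA)[L iL cL].
set B := ((A i `\ x) `|` \bigcup_(j <- J) A j)%fset in cJ.
set C := ((A i `\ y) `|` \bigcup_(j <- L) A j)%fset in cL.
have cU : (#|` J `|` L|.+1 <= #|` B `|` C|)%fset%N.
  have -> : (#|` J `|` L|.+1 = #|` i |` (J `|` L)|)%fset.
    by rewrite cardfsU1 in_fsetU negb_or iJ iL.
  apply: (leq_trans (hA _)); apply/fsubset_leq_card/fsubsetP => z.
  move=> /fbigcupP[j]; rewrite in_fset1U in_fsetU.
  move=> /orP[/eqP->{j} zi|/orP[]j_ zj].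
  - rewrite in_fsetU !in_fsetU !in_fsetD1 zi !andbT.
    by have [->|//] := eqVneq z x; rewrite xy !orbT.
  - rewrite in_fsetU /B in_fsetU; apply/orP; left; apply/orP; right.
    by apply/fbigcupP; exists j; rewrite ?j_.
  - rewrite in_fsetU /C [z \in (_ `|` _)%fset in X in _ || X]in_fsetU.
    apply/orP; right; apply/orP; right.
    by apply/fbigcupP; exists j; rewrite ?j_.
have cI : (#|` J `&` L| <= #|` B `&` C|)%fset%N.
  apply: (leq_trans (hA _)); apply/fsubset_leq_card/fsubsetP => z.
  move=> /fbigcupP[j]; rewrite in_fsetI => /andP[jJ jL] zj.
  rewrite in_fsetI !in_fsetU; apply/andP; split;
    by apply/orP; right; apply/fbigcupP; exists j; rewrite ?jJ ?jL.
have := cardfsUI J L; have := cardfsUI B C; lia.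
Qed.

(** At each index some member of the chain has the fewest elements, hence is smallest there. On a
    finite set of indices one single member of the chain attains all these minima, so Hall's
    condition passes to the limit. *)
Lemma hall_chain_inf (A : I -> {fset T}) (F : set (I -> {fset T})) :
  F !=set0 -> F `<=` hall_condition ->
  (forall B C, F B -> F C ->
    (forall i, B i `<=` C i)%fset \/ (forall i, C i `<=` B i)%fset) ->
  exists2 M, hall_condition M & forall B i, F B -> (M i `<=` B i)%fset.
Proof.
move=> [B0 FB0] hF totF.
have minF i : exists B, F B /\ forall C, F C -> (B i `<=` C i)%fset.
  have exn : exists n, `[< exists2 B, F B & #|` B i| = n >].
    by exists #|` B0 i|; apply/asboolP; exists B0.
  case: (ex_minnP exn) => n /asboolP[B FB Bn] minn; exists B; split=> // C FC.
  have [/(_ i)//|/(_ i) CB] := totF B C FB FC.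
  suff -> : B i = C i by [].
  apply/esym/eqP; rewrite eqEfcard CB Bn /=.
  by apply: minn; apply/asboolP; exists C.
have [m mP] := choice minF; exists (fun i => m i i); last first.
  by move=> B i FB; have [_] := mP i; apply.
have common (s : seq I) : exists2 B, F B & forall i, i \in s -> (B i `<=` m i i)%fset.
  elim: s => [|i s [B FB Bs]]; first by exists B0.
  have [Fi _] := mP i.
  have [le|le] := totF _ _ FB Fi; [exists B => // j|exists (m i) => // j];
    rewrite inE => /predU1P[->//|js]; [exact: Bs|].
  exact: fsubset_trans (le _) (Bs _ js).
move=> J; have [B FB BJ] := common J.
apply: (leq_trans (hF _ FB J)); apply/fsubset_leq_card/fsubsetP => z.
move=> /fbigcupP[j jJ zj]; apply/fbigcupP.
by exists j; rewrite ?jJ//; apply: (fsubsetP (BJ j jJ)).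
Qed.

(* Rado's argument: a minimal family satisfying Hall's condition consists of
   singletons. *)
Theorem hall_matching (A : I -> {fset T}) :
  hall_condition A -> exists2 f : I -> T, injective f & forall i, f i \in A i.
Proof.
move=> hA.
pose S := {B : I -> {fset T} | hall_condition B /\ forall i, (B i `<=` A i)%fset}.
(* The order is reversed, so that Zorn's maximal elements are minimal families. *)
pose le (B C : S) := `[< forall i, (sval C i `<=` sval B i)%fset >].
have [|||F totF|[M [hM MA]] Mmin] := @Zorn S le.
- by move=> B; apply/asboolP => i.
- move=> B C D /asboolP BC /asboolP CD; apply/asboolP => i.
  exact: fsubset_trans (CD i) (BC i).
- move=> [B hB] [C hC] /asboolP/= BC /asboolP/= CB; apply: eq_exist => /=.
  by apply/funext => i; apply/eqP; rewrite eqEfsubset CB BC.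
- have [[B0 FB0]|F0] := pselect (F !=set0); last first.
    exists (exist _ A (conj hA (fun i => fsubset_refl (A i)))) => B FB.
    by exfalso; apply: F0; exists B.
  have [||B C [B' FB' <-] [C' FC' <-]|M hM MF] :=
    @hall_chain_inf A [set sval B | B in F].
  + by exists (sval B0), B0.
  + by move=> _ [[B [hB ?]] _ <-].
  + by have [/asboolP|/asboolP] := totF _ _ FB' FC'; [right|left].
  have MA i : (M i `<=` A i)%fset.
    apply: (fsubset_trans (MF _ i (ex_intro2 _ _ B0 FB0 erefl))).
    by case: B0 {FB0} => B [].
  exists (exist _ M (conj hM MA)) => B FB; apply/asboolP => i.
  by apply: MF; exists B.
have uniqM i x y : x \in M i -> y \in M i -> x = y.
  move=> xi yi; apply/eqP/negPn/negP => xy.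
  have rm z : z \in M i -> ~ hall_condition (remove_at M i z).
    move=> zi hz.
    have sub j : (remove_at M i z j `<=` M j)%fset.
      by rewrite /remove_at; case: eqP => // ->; exact: fsubD1set.
    have subA j : (remove_at M i z j `<=` A j)%fset by exact: fsubset_trans (sub j) (MA j).
    have /Mmin/(congr1 (fun f : S => z \in sval f i))/= :
        le (exist _ M (conj hM MA)) (exist _ _ (conj hz subA)).
      by apply/asboolP => j /=; exact: sub.
    by rewrite zi /remove_at eqxx in_fsetD1 eqxx.
  by have [/rm|/rm] := hall_remove hM xy xi yi; apply.
have exM i : exists x, x \in M i.
  have := hM [fset i]%fset; rewrite big_seq_fset1 cardfs1.
  by rewrite cardfs_gt0 => /fset0Pn.
have [f fM] := choice exM; exists f => [i j fij|i]; last exact: (fsubsetP (MA i)).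
apply/eqP/negPn/negP => ij.
have := hM [fset i; j]%fset; rewrite cardfs2 ij.
have -> : (\bigcup_(k <- [fset i; j]) M k = [fset f i])%fset.
  apply/fsetP => z; rewrite in_fset1; apply/fbigcupP/eqP.
    move=> [k]; rewrite in_fset2 => /orP[]/eqP-> zk; last rewrite fij;
    exact: uniqM zk (fM _).
  by move=> ->; exists i => //; rewrite in_fset2 eqxx.
by rewrite cardfs1.
Qed.

End Hall.

(** * Folner sets from an invariant mean *)

Section Folner.
Context (Q : choiceType) (mul : Q -> Q -> Q) (inv : Q -> Q) (e : Q).
Hypothesis grp : is_group mul inv e.

Definition fset_mul (E F : {fset Q}) : {fset Q} := [fset mul s a | s in E, a in F]%fset.

Lemma fset_mulA (E F G : {fset Q}) :
  fset_mul E (fset_mul F G) = fset_mul (fset_mul E F) G.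
Proof.
have [mA _ _] := grp.
apply/fsetP => x; apply/imfset2P/imfset2P.
  move=> [s sE [_ /imfset2P[t tF [a aG ->]] ->]].
  by exists (mul s t); [exact: in_imfset2|exists a => //; rewrite mA].
move=> [_ /imfset2P[s sE [t tF ->]] [a aG ->]].
by exists s => //; exists (mul t a); [exact: in_imfset2|rewrite mA].
Qed.

Lemma fset_mul1 (F : {fset Q}) : fset_mul [fset e]%fset F = F.
Proof.
have [_ m1 _] := grp.
apply/fsetP => x; apply/imfset2P/idP => [[s + [a aF ->]]|xF].
  by rewrite inE => /eqP->; rewrite (m1 a).1.
by exists e; [rewrite inE|exists x => //; rewrite (m1 x).1].
Qed.

Lemma group_mulI (s a b : Q) : mul s a = mul s b -> a = b.
Proof.
have [mA m1 mV] := grp => /(congr1 (mul (inv s))).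
by rewrite !mA (mV s).1 (m1 a).1 (m1 b).1.
Qed.

(** Each of the two maps [phi (_, b)] is piecewise a left translation, with finitely many pieces, so
    its image has measure 1; two disjoint sets of measure 1 do not fit into [Q]. *)
Lemma amenable_no_doubling (E : {fset Q}) (phi : Q * bool -> Q) :
  amenable_group mul -> injective phi ->
  (forall p, exists2 s, s \in E & phi p = mul s p.1) -> False.
Proof.
move=> [mu [mu1 mu0 muD muI]] phi_inj phiE.
have disjoint_image (b c : bool) (A B : set Q) :
    b != c \/ A `&` B = set0 ->
    [set phi (a, b) | a in A] `&` [set phi (a, c) | a in B] = set0.
  move=> dis; rewrite -subset0 => _ [[a Aa <-] [a' Ba' /phi_inj[aa cb]]].
  case: dis => [|/seteqP[+ _]]; first by rewrite cb eqxx.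
  by move=> /(_ a); apply; split=> //; rewrite -aa.
have mu_set0 : mu set0 = 0.
  by have := muD set0 set0 (set0I _); rewrite setU0 => ?; lra.
(* Induction on the list of allowed translations: the part of [A] moved by [t] is translated, the
   rest needs only the remaining list. *)
have mu_image b (s : seq Q) : forall A : set Q,
    (forall a, A a -> exists2 t, t \in s & phi (a, b) = mul t a) ->
    mu [set phi (a, b) | a in A] = mu A.
  elim: s => [|t s IH] A As.
    suff -> : A = set0 by rewrite image_set0.
    by rewrite -subset0 => a /As[].
  pose A1 := A `&` [set a | phi (a, b) = mul t a].
  pose A2 := A `&` [set a | phi (a, b) <> mul t a].
  have AE : A = A1 `|` A2.
    by rewrite -setIUr; apply/seteqP; split=> [a Aa|a [//]]; split=> //; exact: EM.
  have A120 : A1 `&` A2 = set0 by rewrite -subset0 => a [[_ /= ?] [_ /=]].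
  rewrite {1}AE image_setU muD; last exact: disjoint_image (or_intror A120).
  rewrite [in RHS]AE muD//; congr (_ + _).
    rewrite -(muI t A1); congr mu; apply/seteqP; split=> _ [a [Aa at_] <-];
    by exists a => //; rewrite at_.
  apply: IH => a [Aa nat]; have [u] := As a Aa.
  by rewrite inE => /predU1P[->|us] ?; [|exists u].
have muT b : mu [set phi (a, b) | a in setT] = 1.
  rewrite (mu_image b E) ?mu1// => a _; exact: phiE (a, b).
pose U := [set phi (a, false) | a in setT] `|` [set phi (a, true) | a in setT].
have := muD U (~` U) (setICr U); rewrite setUCr mu1.
rewrite /U muD ?muT; last exact: disjoint_image (or_introl _).
by have := mu0 (~` U); rewrite /U => ? ?; lra.
Qed.

Lemma amenable_folner_left (E : {fset Q}) (eps : R) :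
  amenable_group mul -> 0 < eps -> e \in E ->
  exists2 F : {fset Q}, F != fset0 &
    #|` fset_mul E F|%:R <= (1 + eps) * #|` F|%:R.
Proof.
move=> am eps0 eE; apply: contrapT => nF.
have grow (F : {fset Q}) : (1 + eps) * #|` F|%:R <= #|` fset_mul E F|%:R.
  have [->|F0] := eqVneq F fset0; first by rewrite cardfs0 mulr0.
  by apply/ltW; rewrite real_ltNge ?num_real//; apply/negP => le; apply: nF; exists F.
pose En n := iter n (fset_mul E) [fset e]%fset.
have growN n (F : {fset Q}) : (1 + eps) ^+ n * #|` F|%:R <= #|` fset_mul (En n) F|%:R.
  elim: n => [|n IH]; first by rewrite expr0 mul1r fset_mul1.
  rewrite exprS -mulrA /En iterS -/(En n) -fset_mulA.
  apply: le_trans (grow _); rewrite ler_pM2l//; lra.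
(* By Bernoulli's inequality any [n] with n eps >= 1 works. *)
have [n n2] : exists n, 2 <= (1 + eps) ^+ n.
  have bernoulli n : 1 + n%:R * eps <= (1 + eps) ^+ n.
    elim: n => [|n IH]; first by rewrite mul0r addr0 expr0.
    rewrite exprS; apply: (@le_trans _ _ ((1 + eps) * (1 + n%:R * eps))).
      have : 0 <= n%:R * (eps * eps) by rewrite mulr_ge0 ?mulr_ge0// ltW.
      by rewrite -natr1; lra.
    by rewrite ler_pM2l//; lra.
  have /archi_boundP := ltW (divr_gt0 ltr01 eps0).
  set n := Num.bound _ => n1; exists n; apply: le_trans (bernoulli n).
  by move: n1; rewrite ltr_pdivrMr// => n1; lra.
(* Both copies of a point share the same choices, so a set [J] of pairs has at least half as many
   first coordinates as elements, and growth by the factor 2 makes up for this. *)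
have hall : hall_condition (fun p : Q * bool => fset_mul (En n) [fset p.1]%fset).
  move=> J; pose J1 := [fset p.1 | p in J]%fset.
  have -> : (\bigcup_(p <- J) fset_mul (En n) [fset p.1] = fset_mul (En n) J1)%fset.
    apply/fsetP => x; apply/fbigcupP/imfset2P.
      move=> [p pJ /imfset2P[s sE [a]]]; rewrite inE => /eqP -> ->.
      by exists s => //; exists p.1 => //; exact: in_imfset.
    move=> [s sE [_ /imfsetP[p pJ ->] ->]]; exists p => //.
    by apply/in_imfset2 => //; rewrite inE.
  have cJ : (#|` J| <= 2 * #|` J1|)%N.
    pose pr (b : bool) := [fset (a, b) | a in J1]%fset.
    have cpr b : #|` pr b| = #|` J1| by apply: card_imfset => a a' [].
    have /fsubset_leq_card/leq_trans : (J `<=` pr true `|` pr false)%fset.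
      apply/fsubsetP => -[a b] abJ; rewrite in_fsetU; apply/orP.
      have aJ1 : a \in J1 by apply/imfsetP; exists (a, b).
      by case: b abJ => _; [left|right]; apply/imfsetP; exists a.
    by apply; rewrite cardfsU !cpr; lia.
  have := growN n J1; rewrite -(ler_nat R) => le; apply: le_trans le.
  rewrite -(ler_nat R) natrM in cJ; apply: (le_trans cJ).
  by rewrite ler_wpM2r.
have [phi phi_inj phiE] := hall_matching hall.
apply: (@amenable_no_doubling (En n) phi am phi_inj) => p.
have /imfset2P[s sE [a]] := phiE p; rewrite inE => /eqP -> ->.
by exists s.
Qed.

Lemma group_inv_inv (a : Q) : inv (inv a) = a.
Proof.
have [mA m1 mV] := grp.
by apply: (@group_mulI (inv a)); rewrite (mV _).2 (mV _).1.
Qed.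

Lemma group_inv_inj : injective inv.
Proof. exact: can_inj group_inv_inv. Qed.

Lemma group_inv_mul (a b : Q) : inv (mul a b) = mul (inv b) (inv a).
Proof.
have [mA m1 mV] := grp.
apply: (@group_mulI (mul a b)); rewrite (mV _).2 -mA (mA b) (mV b).2 (m1 _).1.
by rewrite (mV a).2.
Qed.

(** Inversion turns a left Folner set [A] into a right one: b |-> q^-1 b^-1 embeds the points of
    A^-1 that leave it under right translation by q into [EA] minus [A]. Adjoining [e] ensures that
    [A] lies in [EA], so that the size of the difference is a difference of sizes. *)
Lemma amenable_folner (E : {fset Q}) (eps : R) :
  amenable_group mul -> 0 < eps ->
  exists2 F : {fset Q}, F != fset0 & forall q, q \in E ->
    #|` [fset b in F | mul b q \notin F]%fset|%:R <= eps * #|` F|%:R.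
Proof.
move=> am eps0; have [mA m1 mV] := grp.
have [|A A0 cA] := @amenable_folner_left (e |` [fset inv q | q in E])%fset eps am eps0.
  by rewrite !inE eqxx.
exists [fset inv a | a in A]%fset.
  have /fset0Pn[a aA] := A0; apply/fset0Pn; exists (inv a); exact: in_imfset.
move=> q qE; have -> : #|` [fset inv a | a in A]%fset| = #|` A|.
  by apply: card_imfset; exact: group_inv_inj.
set EA := fset_mul _ A in cA; set B := [fset b in _ | _]%fset.
have AEA : (A `<=` EA)%fset.
  rewrite -[X in (X `<=` _)%fset]fset_mul1.
  apply/fsubsetP => _ /imfset2P[s + [a aA ->]]; rewrite inE => /eqP->.
  by apply: in_imfset2 => //; rewrite !inE eqxx.
have cB : (#|` B| <= #|` EA `\` A|)%fset%N.
  have <- : #|` [fset mul (inv q) (inv b) | b in B]%fset| = #|` B|.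
    by apply: card_imfset => b c /group_mulI/group_inv_inj.
  apply/fsubset_leq_card/fsubsetP => _ /imfsetP[b + ->].
  rewrite !inE => /andP[/imfsetP[a aA ->] naq]; apply/andP; split.
    apply: contra naq => naq; apply/imfsetP.
    by exists (mul (inv q) (inv (inv a))) => //; rewrite group_inv_mul !group_inv_inv.
  rewrite group_inv_inv; apply: in_imfset2 => //; rewrite !inE; apply/orP; right.
  exact: in_imfset.
have := cardfsDS AEA; have := fsubset_leq_card AEA => le1 le2.
move: cB; rewrite le2 -(ler_nat R) natrB// => cB.
by apply: (le_trans cB); lra.
Qed.

End Folner.

(** * Compactness and bump functions *)

Section Compact.
Context {R : realType} (T : topologicalType).

(** If [P C] failed, the sets [A] such that [P] holds for the part of [C] outside [A] would form a
    proper filter containing [C], and the local hypothesis would contradict its having a cluster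
    point in [C]. *)
Lemma compact_ind (P : set T -> Prop) (C : set T) :
  compact C -> P set0 ->
  (forall A B, P A -> P B -> P (A `|` B)) ->
  (forall A B, A `<=` B -> P B -> P A) ->
  (forall x, C x -> exists2 U, nbhs x U & P U) -> P C.
Proof.
move=> cC P0 PU Psub Ploc; apply: contrapT => nPC.
pose F := [set A | P (C `\` A)].
have FF : ProperFilter F.
  split=> [F0|]; first by apply: nPC; move: F0; rewrite /F/= setD0.
  split=> [|A B FA FB|A B AB FA]; rewrite /F/=; first by rewrite setDT.
    by rewrite setDIr; exact: PU.
  by apply: Psub FA => x [Cx nBx]; split=> // /AB.
have [|x [Cx /(_ (~` _) _ _) clx]] := cC F FF; first by rewrite /F/= setDv.
have [U xU PU_] := Ploc x Cx.
have [|y []//] := clx U U _ xU.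
by apply: Psub PU_ => y [_ /contrapT].
Qed.

Context (hT : hausdorff_space T) (lcT : locally_compact [set: T]).

Lemma locally_compact_nbhs (x : T) (D : set T) : open D -> D x ->
  exists2 K, nbhs x K & compact K /\ K `<=` D.
Proof.
move=> oD Dx.
have [U xU [cU clU]] := @lcT x I; rewrite withinET in xU.
have reg : regular_space T.
  apply: (@completely_regular_regular R).
  exact: (@locally_compact_completely_regular T R (@lcT) hT).
have [V xV VD] := reg x D (open_nbhs_nbhs (conj oD Dx)).
exists (closure V `&` U).
  by apply: filterI => //; apply: filterS xV; exact: subset_closure.
split; last by move=> y [/VD].
by rewrite setIC; apply: compact_closedI => //; exact: closed_closure.
Qed.

Definition bumpable (D C : set T) := exists (g : T -> R) (K : set T),
  [/\ continuous g, (forall x, 0 <= g x <= 1), (forall x, C x -> g x = 1),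
      compact K /\ K `<=` D & forall x, ~ K x -> g x = 0].

Lemma compact_bump (D C : set T) : open D -> compact C -> C `<=` D -> bumpable D C.
Proof.
move=> oD cC CD; apply: (compact_ind cC).
- exists (fun=> 0), set0; split=> //; first by move=> x; exact: cvg_cst.
  + by move=> x; rewrite lexx ler01.
  + by split=> //; exact: compact0.
- move=> A B [f [K [cf f01 f1 [cK KD] f0]]] [g [L [cg g01 g1 [cL LD] g0]]].
  (* This is 1 - (1 - f)(1 - g): it equals 1 where either function does and vanishes where both
     do. *)
  exists (fun x => f x + g x - f x * g x), (K `|` L); split.
  + move=> x; apply: (@continuousB R R^o T (f \+ g) (f \* g)).
      by apply: continuousD; [exact: cf|exact: cg].
    by apply: continuousM; [exact: cf|exact: cg].
  + move=> x; have /andP[fx0 fx1] := f01 x; have /andP[gx0 gx1] := g01 x.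
    have h1 : 0 <= (1 - f x) * (1 - g x) by rewrite mulr_ge0// subr_ge0.
    have h2 : 0 <= f x * (1 - g x) by rewrite mulr_ge0// subr_ge0.
    by apply/andP; split; lra.
  + by move=> x [/f1->|/g1->]; lra.
  + by split=> [|x [/KD|/LD]//]; exact: compactU.
  + by move=> x /not_orP[/f0-> /g0->]; lra.
- move=> A B AB [g [K [cg g01 g1 KD g0]]]; exists g, K; split=> // x /AB; exact: g1.
move=> x Cx; have [K xK [cK KD]] := locally_compact_nbhs oD (CD x Cx).
have sep : uniform_separator [set x] (~` K°).
  apply: (@locally_compact_completely_regular T R (@lcT) hT).
    by apply: open_closedC; exact: open_interior.
  by move=> nxK; exact: (nxK xK).
have /(@uniform_separatorP T R)[f [cf f01 fx f1]] := sep.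
have {}f01 y : 0 <= f y <= 1.
  by have := f01 (f y); rewrite /= in_itv/=; apply; exists y.
have {}f1 y : ~ K y -> f y = 1.
  by move=> nKy; apply: f1; exists y => //= /interior_subset.
have {}fx : f x = 0 by apply: fx; exists x.
(* [f] is 0 at [x] and 1 outside [K]. [clip] is 1 up to 1/4 and 0 from 1/2 on, so [clip \o f] is 1
   on a whole neighbourhood of [x] and is supported in a closed subset of [K]. *)
pose clip (r : R) := Num.min 1 (Num.max 0 (2 - 4 * r)).
exists (f @^-1` `]-oo, 1/4[).
  apply: cf; rewrite fx; apply: open_nbhs_nbhs; split; first exact: interval_open.
  by rewrite /= in_itv/=; lra.
exists (clip \o f), (f @^-1` `]-oo, 1/2]); split.
- move=> y; apply: continuous_comp; first exact: cf.
  apply: continuous_min; first exact: cvg_cst.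
  apply: continuous_max; first exact: cvg_cst.
  apply: (@continuousB R R^o R (cst 2) ( *%R 4)); first exact: cvg_cst.
  exact: mulrl_continuous.
- by move=> y; rewrite /= /clip le_min ge_min le_max !lexx ler01.
- move=> y /=; rewrite in_itv/= /clip => fy.
  by rewrite max_r ?min_l//; lra.
- have cl : closed (f @^-1` `]-oo, 1/2]).
    by apply: closed_comp => [z _|]; [exact: cf|exact: interval_closed].
  have sub : f @^-1` `]-oo, 1/2] `<=` K.
    move=> y /=; rewrite in_itv/= => fy; apply: contrapT => /f1 fy1.
    by move: fy; rewrite fy1; lra.
  by split; [exact: subclosed_compact cl cK sub|exact: subset_trans sub KD].
- move=> y /=; rewrite in_itv/= => /negP; rewrite -ltNge /clip => fy.
  by rewrite max_l ?min_r//; lra.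
Qed.

End Compact.

Lemma continuous_sum {R : realType} {T : topologicalType} {I : Type} (s : seq I)
    (f : I -> T -> R) :
  (forall i, continuous (f i)) -> continuous (fun x => \sum_(i <- s) f i x).
Proof.
move=> cf; elim: s => [|i s IH].
  rewrite (_ : (fun _ => _) = cst 0); first by move=> x; exact: cvg_cst.
  by apply/funext => x; rewrite big_nil.
rewrite (_ : (fun _ => _) = f i \+ (fun x => \sum_(i <- s) f i x)).
  by move=> x; apply: (@continuousD R R^o); [exact: cf|exact: IH].
by apply/funext => x; rewrite big_cons.
Qed.

Lemma continuous_near0 {R : realType} {T : topologicalType} (f : T -> R) (x : T) :
  (\forall z \near x, f z = 0) -> {for x, continuous f}.
Proof.
move=> f0; apply: (@cvg_trans _ (cst 0 @ x)).
  by apply: near_eq_cvg; apply: filterS f0 => z ->.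
by rewrite (nbhs_singleton f0); exact: cvg_cst.
Qed.

Lemma esum_single {R : realType} (T : choiceType) (A : set T) (f : T -> \bar R) (t0 : T) :
  A t0 -> (0 <= f t0)%E -> (forall t, A t -> t <> t0 -> f t = 0%E) ->
  (\esum_(t in A) f t = f t0)%E.
Proof.
move=> At0 f0 fz; rewrite (esumID [set t0]); last first.
  move=> t At; have [->|/eqP tt0] := eqVneq t t0; first exact: f0.
  by rewrite fz.
rewrite [X in (_ + X)%E]esum1 ?adde0; last by move=> t [At nt]; exact: fz.
rewrite (_ : A `&` [set t0] = [set t0]); first exact: esum_set1.
by apply/seteqP; split=> [t []//|t ->]; split.
Qed.

(** * Approximately invariant kernels for directed systems of partial maps *)

Section Kernel.
Context {R : realType} {Y : Type}.

(* The finite combination of point masses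
   [x |-> \sum_i wt i x *: dirac (tg i x)]. *)
Record kernel := Kernel {
  ix : finType; wt : ix -> Y -> R; tg : ix -> Y -> Y }.

Definition ev (mu : kernel) (x : Y) (t : Y -> R) : R :=
  \sum_i @wt mu i x * t (@tg mu i x).

Definition stochastic (mu : kernel) :=
  (forall i x, 0 <= @wt mu i x) /\ forall x, \sum_i @wt mu i x = 1.

Definition point_kernel (tau : Y -> Y) : kernel :=
  @Kernel unit (fun _ _ => 1) (fun=> tau).

Definition mix (w : Y -> R) (mu nu : kernel) : kernel :=
  @Kernel (ix mu + ix nu)%type
    (fun i x => match i with
                | inl i => w x * @wt mu i x
                | inr i => (1 - w x) * @wt nu i x
                end)
    (fun i => match i with inl i => @tg mu i | inr i => @tg nu i end).

(* An upper bound on the l^1-distance, stated in dual form. *)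
Definition close (eta : R) (mu : kernel) (x y : Y) := forall t : Y -> R,
  (forall z, `|t z| <= 1) -> `|ev mu x t - ev mu y t| <= eta.

Lemma ev_mix w mu nu x t :
  ev (mix w mu nu) x t = w x * ev mu x t + (1 - w x) * ev nu x t.
Proof.
rewrite /ev big_sumType/= !mulr_sumr.
by congr (_ + _); apply: eq_bigr => i _; rewrite mulrA.
Qed.

Lemma ev_point tau x t : ev (point_kernel tau) x t = t (tau x).
Proof. by rewrite /ev (big_pred1 tt) ?mul1r// => -[]. Qed.

Lemma stochastic_point tau : stochastic (point_kernel tau).
Proof. by split=> [i x|x] /=; rewrite ?ler01// (big_pred1 tt)// => -[]. Qed.

Lemma stochastic_mix w mu nu : (forall x, 0 <= w x <= 1) ->
  stochastic mu -> stochastic nu -> stochastic (mix w mu nu).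
Proof.
move=> w01 [mu0 mu1] [nu0 nu1]; split=> [[i|i] x|x] /=.
- by rewrite mulr_ge0//; have /andP[] := w01 x.
- by rewrite mulr_ge0// subr_ge0; have /andP[] := w01 x.
- by rewrite big_sumType/= -!mulr_sumr mu1 nu1; lra.
Qed.

Lemma ev_bound mu x t : stochastic mu -> (forall z, `|t z| <= 1) -> `|ev mu x t| <= 1.
Proof.
move=> [mu0 mu1] t1; rewrite /ev -(mu1 x).
apply: (le_trans (ler_norm_sum _ _ _)); apply: ler_sum => i _.
by rewrite normrM ger0_norm// ler_piMr.
Qed.

Lemma close_le eta eta' mu x y : eta <= eta' -> close eta mu x y -> close eta' mu x y.
Proof. by move=> le h t t1; apply: le_trans (h t t1) le. Qed.

(** The difference splits into the two differences weighted at [x] and (w x - w y) times a quantity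
    of size at most 2. A component of weight zero at [x] need not be close there, so each kernel has
    to be good only where it is used. *)
Lemma close_mix (w : Y -> R) mu nu x y delta eta :
  stochastic mu -> stochastic nu -> 0 <= w x <= 1 -> `|w x - w y| <= delta ->
  (w x != 0 -> close eta mu x y) -> (w x != 1 -> close eta nu x y) ->
  close (eta + 2 * delta) (mix w mu nu) x y.
Proof.
move=> smu snu /andP[w0 w1] dw cmu cnu t t1; rewrite !ev_mix.
set a := ev mu x t; set b := ev mu y t; set c := ev nu x t; set d := ev nu y t.
have -> : w x * a + (1 - w x) * c - (w y * b + (1 - w y) * d) =
  (w x * (a - b) + (1 - w x) * (c - d)) + (w x - w y) * (b - d) by ring.
apply: (le_trans (ler_normD _ _)); apply: lerD.
  have -> : eta = w x * eta + (1 - w x) * eta by ring.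
  apply: (le_trans (ler_normD _ _)); apply: lerD; rewrite normrM ger0_norm ?subr_ge0//.
    have [->|wx0] := eqVneq (w x) 0; first by rewrite !mul0r.
    by rewrite ler_wpM2l//; exact: cmu.
  have [->|wx1] := eqVneq (w x) 1; first by rewrite subrr !mul0r.
  by rewrite ler_wpM2l ?subr_ge0//; exact: cnu.
rewrite normrM mulrC; apply: ler_pM => //.
have := ev_bound y smu t1; have := ev_bound y snu t1; rewrite -/b -/d => d1 b1.
by apply: (le_trans (ler_normB _ _)); lra.
Qed.

End Kernel.
Arguments kernel : clear implicits.

(** * Directed systems of partial maps with local sections *)

Section System.
Context {R : realType} (X Y : topologicalType) (Q : Type).
Context (hX : hausdorff_space X) (lcX : locally_compact [set: X]).
Context (hY : hausdorff_space Y) (lcY : locally_compact [set: Y]).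
Context (ple : Q -> Q -> Prop) (D : Q -> set Y) (S : Q -> Y -> X).
Hypothesis ple_refl : forall k, ple k k.
Hypothesis ple_trans : forall k l m, ple k l -> ple l m -> ple k m.
Hypothesis D_open : forall k, open (D k).
Hypothesis D_cover : forall y, exists k, D k y.
Hypothesis D_directed : forall k l y, D k y -> D l y ->
  exists r, [/\ ple k r, ple l r & D r y].
Hypothesis S_continuous : forall k y, D k y -> {for y, continuous (S k)}.
Hypothesis S_le : forall k l y z, ple k l -> D k y -> D k z -> S k y = S k z ->
  D l y -> D l z /\ S l y = S l z.
Hypothesis S_section : forall k y, D k y ->
  exists (V : set X) (sigma : X -> Y), [/\ open V, V (S k y) &
    forall v, V v -> [/\ D k (sigma v), S k (sigma v) = v & {for v, continuous sigma}]].

Context (I : choiceType) (k : I -> Q) (C : I -> set Y).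
Hypothesis C_compact : forall i, compact (C i).
Hypothesis C_sub : forall i, C i `<=` D (k i).

Definition piece (i : I) (x y : Y) := [/\ C i x, C i y & S (k i) x = S (k i) y].

Lemma piece_sym i x y : piece i x y -> piece i y x.
Proof. by case. Qed.

(** This is the properness of a piece: the set is [C i] cut with the preimage of the compact set
    [E]. Since [S (k i)] is only known to be continuous on [D (k i)], closedness is checked
    pointwise, using the closedness of [C i] at points outside it. *)
Lemma translate_compact (i : I) (L : set Y) : compact L ->
  compact [set y | exists2 x, L x & piece i x y].
Proof.
move=> cL; pose E := S (k i) @` (L `&` C i).
have clC : closed (C i) by apply: compact_closed.
have cE : closed E.
  apply: compact_closed => //; apply: continuous_compact.
    apply: continuous_in_subspaceT => y; rewrite inE => -[_ /C_sub].
    exact: S_continuous.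
  by rewrite setIC; apply: compact_closedI => //; apply: compact_closed.
set A := [set y | _].
have AE : A = C i `&` (S (k i) @^-1` E).
  apply/seteqP; split=> y.
    by move=> [x Lx [Cx Cy Sxy]]; split=> //; exists x.
  by move=> [Cy [x [Lx Cx] Sxy]]; exists x.
apply: (subclosed_compact _ (@C_compact i)); last by move=> y; rewrite AE => -[].
rewrite -[A]setCK; apply: open_closedC; rewrite openE => y nAy.
have [Cy|nCy] := pselect (C i y); last first.
  apply: (@filterS _ (nbhs y) _ (~` C i)); first by move=> z nCz; rewrite AE => -[].
  by apply: open_nbhs_nbhs; split=> //; exact: closed_openC.
have nE : nbhs (S (k i) y) (~` E).
  apply: open_nbhs_nbhs; split; first exact: closed_openC.
  by move=> Ey; apply: nAy; rewrite AE.
apply: (@filterS _ (nbhs y) _ (S (k i) @^-1` (~` E))).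
  by move=> z nEz; rewrite /= AE => -[_].
exact: (S_continuous (C_sub Cy) nE).
Qed.

(* The average of a chain of bump functions in which each one equals 1 on the
   translates of the support of the previous one: along a piece the average then
   varies by at most 1/N. *)
Lemma almost_invariant_bump (s : seq I) (U B : set Y) (delta : R) :
  open U -> (forall i x y, i \in s -> piece i x y -> U x -> U y) ->
  compact B -> B `<=` U -> 0 < delta ->
  exists (w : Y -> R) (K : set Y),
    [/\ [/\ continuous w, forall x, 0 <= w x <= 1 & forall x, B x -> w x = 1],
        compact K, K `<=` U, (forall x, ~ K x -> w x = 0) &
        forall i x y, i \in s -> piece i x y -> `|w x - w y| <= delta].
Proof.
move=> oU sU cB BU delta0.
(* The conditions on [L] are premises inside the existential, so that [choice] gives a function of
   every set, which can be iterated. *)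
have next (L : set Y) : exists gK : (Y -> R) * set Y, compact L -> L `<=` U ->
  [/\ [/\ continuous gK.1, forall x, 0 <= gK.1 x <= 1 & forall x, L x -> gK.1 x = 1],
      compact gK.2, gK.2 `<=` U, (forall x, ~ gK.2 x -> gK.1 x = 0) &
      forall i x y, i \in s -> L x -> piece i x y -> gK.1 y = 1].
  have [[cL LU]|nL] := pselect (compact L /\ L `<=` U); last first.
    by exists (fun=> 0, set0) => cL LU; exfalso; exact: nL.
  pose L' := L `|` [set y | exists i, i \in s /\ exists2 x, L x & piece i x y].
  have cL' : compact L'.
    apply: compactU => //.
    suff : forall s0 : seq I,
        compact [set y | exists i, i \in s0 /\ exists2 x, L x & piece i x y].
      exact.
    elim=> [|i s0 IH].
      by rewrite (_ : mkset _ = set0); [exact: compact0|rewrite -subset0 => y [? []]].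
    rewrite (_ : mkset _ = [set y | exists2 x, L x & piece i x y] `|`
       [set y | exists i, i \in s0 /\ exists2 x, L x & piece i x y]).
      by apply: compactU => //; exact: translate_compact.
    apply/seteqP; split=> y.
      by move=> [j []]; rewrite inE => /predU1P[->|js] h; [left|right; exists j].
    by case=> [h|[j [js h]]]; [exists i|exists j]; rewrite inE ?eqxx ?js ?orbT.
  have L'U : L' `<=` U.
    move=> y [/LU//|[i [is_ [x Lx pxy]]]]; exact: sU is_ pxy (LU _ Lx).
  have [g [K [cg g01 g1 [cK KU] g0]]] := @compact_bump R Y hY (@lcY) U L' oU cL' L'U.
  exists (g, K) => _ _; split=> //=.
    by split=> // x Lx; apply: g1; left.
  by move=> i x y is_ Lx pxy; apply: g1; right; exists i; split=> //; exists x.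
have [f fP] := choice next.
(* [g n] is 1 on [L n] and on its translates along the pieces, and is supported in [L n.+1]. *)
pose L n := iter n (fun L => (f L).2) B.
pose g n := (f (L n)).1.
have LU n : compact (L n) /\ L n `<=` U.
  by elim: n => // n [cL LnU]; have [_ ? ? _ _] := fP _ cL LnU.
have gP n := fP _ (LU n).1 (LU n).2.
have g01 n x : 0 <= g n x <= 1 by have [[_ h _] _ _ _ _] := gP n; exact: h.
have g1 n x : L n x -> g n x = 1 by have [[_ _ h] _ _ _ _] := gP n; exact: h.
have g0 n x : ~ L n.+1 x -> g n x = 0 by have [_ _ _ h _] := gP n; exact: h.
have LS n x : L n x -> L n.+1 x.
  by move=> /g1 gx1; apply: contrapT => /g0; rewrite gx1; lra.
have Lmono m n x : (m <= n)%N -> L m x -> L n x.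
  elim: n => [|n IH]; first by rewrite leqn0 => /eqP->.
  by rewrite leq_eqVlt => /predU1P[->//|/IH h /h /LS].
(* If [x] lies in the support [L n.+1] of [g n], then [g n.+1] is 1 at its translate [y]; otherwise
   [g n x] is 0. *)
have gs n i x y : i \in s -> piece i x y -> g n x <= g n.+1 y.
  move=> is_ pxy; have [Lx|/g0->] := pselect (L n.+1 x); last by have /andP[] := g01 n.+1 y.
  have [_ _ _ _ /(_ i x y is_ Lx pxy)] := gP n.+1.
  by rewrite -/(g n.+1) => ->; have /andP[] := g01 n x.
pose N := (Num.bound delta^-1).+1.
have N0 : 0 < N%:R :> R by rewrite ltr0n.
have Ndelta : N%:R^-1 <= delta.
  rewrite invf_ple ?posrE//.
  have /ltW/archi_boundP/ltW : 0 < delta^-1 by rewrite invr_gt0.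
  by move=> /le_trans; apply; rewrite ler_nat.
exists (fun x => N%:R^-1 * \sum_(n < N) g n x), (L N).
(* Bounding [g n x] by [g n.+1 y] makes the difference telescope to (g N y - g 0 y) / N. *)
have var i x y : i \in s -> piece i x y ->
    N%:R^-1 * \sum_(n < N) g n x - N%:R^-1 * \sum_(n < N) g n y <= delta.
  move=> is_ pxy; rewrite -mulrBr.
  apply: (le_trans _ Ndelta).
  rewrite -[leRHS]mulr1 ler_pM2l ?invr_gt0// lerBlDr.
  apply: (@le_trans _ _ (\sum_(n < N) g n.+1 y)).
    by apply: ler_sum => n _; exact: gs is_ pxy.
  have : \sum_(n < N) g n.+1 y - \sum_(n < N) g n y = g N y - g 0 y.
    by rewrite -sumrB -(big_mkord xpredT (fun n => g n.+1 y - g n y)) telescope_sumr.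
  by have /andP[_] := g01 N y; have /andP[+ _] := g01 0%N y; lra.
have cg n : continuous (g n) by have [[h _ _] _ _ _ _] := gP n; exact: h.
split.
- split.
  + move=> x; apply: (@continuousM R Y (cst N%:R^-1) (fun x => \sum_(n < N) g n x)).
      exact: cvg_cst.
    by apply: continuous_sum => n; exact: cg.
  + move=> x; rewrite mulr_ge0 ?invr_ge0 ?sumr_ge0//=; last first.
      by move=> n _; have /andP[] := g01 n x.
    rewrite mulrC ler_pdivrMr// mul1r -[leRHS](_ : \sum_(n < N) 1 = _).
      by apply: ler_sum => n _; have /andP[] := g01 n x.
    by rewrite sumr_const card_ord.
  + move=> x Bx; rewrite (eq_bigr (fun=> 1)); last first.
      by move=> n _; apply: g1; apply: (@Lmono 0).
    by rewrite sumr_const card_ord mulVf// gt_eqF.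
- exact: (LU N).1.
- exact: (LU N).2.
- move=> x nLx; rewrite big1 ?mulr0// => n _; apply: g0 => Ln; apply: nLx.
  by apply: Lmono Ln.
- move=> i x y is_ pxy; rewrite ler_norml lerNl opprB; apply/andP; split.
    exact: var is_ (piece_sym pxy).
  exact: var is_ pxy.
Qed.

(** [D l] is preserved by the pieces below level [l]; by directedness this larger open set is
    preserved by every piece, so almost invariant bumps can be supported in it. *)
Definition eventual_domain (l : Q) : set Y := [set y | exists2 r, ple l r & D r y].

Lemma eventual_domain_open l : open (eventual_domain l).
Proof.
rewrite (_ : eventual_domain l = \bigcup_(r in ple l) D r).
  by apply: bigcup_open => r _; exact: D_open.
by apply/seteqP; split=> y [r ? ?]; exists r.
Qed.

Lemma eventual_domain_piece l i x y :
  piece i x y -> eventual_domain l x -> eventual_domain l y.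
Proof.
move=> [Cx Cy Sxy] [r lr Drx].
have [r' [kr' rr' Dr'x]] := D_directed (C_sub Cx) Drx.
have [Dr'y _] := S_le kr' (C_sub Cx) (C_sub Cy) Sxy Dr'x.
by exists r' => //; exact: ple_trans rr'.
Qed.

Lemma common_level (s : seq I) y :
  (forall i, i \in s -> eventual_domain (k i) y) ->
  exists2 l, D l y & forall i, i \in s -> ple (k i) l.
Proof.
elim: s => [|i s IH] sy; first by have [l Dl] := D_cover y; exists l.
have [l Dl sl] := IH (fun j js => sy j (@mem_behead _ (i :: s) j js)).
have [r ir Dr] := sy i (mem_head i s).
have [m [lm rm Dm]] := D_directed Dl Dr.
exists m => // j; rewrite inE => /predU1P[->|js]; first exact: ple_trans rm.
exact: ple_trans (sl _ js) lm.
Qed.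

(* Where [phi] is not locally zero, [x |-> (x, tau x)] is a continuous section of
   the range map of the etale groupoid formed by the equivalent pairs. *)
Definition moves_along (phi : Y -> R) (tau : Y -> Y) := forall x,
  (\forall z \near x, phi z = 0) \/
  {for x, continuous tau} /\
  exists l, \forall z \near x, [/\ D l z, D l (tau z) & S l z = S l (tau z)].

Definition admissible (mu : kernel R Y) := stochastic mu /\
  forall i, continuous (@wt _ _ mu i) /\ moves_along (@wt _ _ mu i) (@tg _ _ mu i).

Lemma moves_along_le (phi psi : Y -> R) tau : (forall x, phi x = 0 -> psi x = 0) ->
  moves_along phi tau -> moves_along psi tau.
Proof.
move=> phipsi h x; have [h0|] := h x; last by right.
by left; apply: filterS h0 => z; exact: phipsi.
Qed.

Lemma admissible_id : admissible (point_kernel id).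
Proof.
split=> [|i]; first exact: stochastic_point.
split=> [x|x]; first exact: cvg_cst.
right; split; first exact: cvg_id.
have [l Dl] := D_cover x; exists l.
by apply: (@filterS _ (nbhs x) _ (D l)) => //; apply: open_nbhs_nbhs.
Qed.

(** The motion condition on [mu] is imposed only after multiplication by [w]; this admits point
    kernels whose target moves continuously only near the support of [w]. *)
Lemma admissible_mix (w : Y -> R) (mu nu : kernel R Y) :
  continuous w -> (forall x, 0 <= w x <= 1) ->
  stochastic mu ->
  (forall i, continuous (@wt _ _ mu i) /\
     moves_along (fun x => w x * @wt _ _ mu i x) (@tg _ _ mu i)) ->
  admissible nu -> admissible (mix w mu nu).
Proof.
move=> cw w01 smu amu [snu anu]; split; first exact: stochastic_mix.
case=> i /=.
  have [cmu mmu] := amu i; split=> // x.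
  by apply: (@continuousM R Y w); [exact: cw|exact: cmu].
have [cnu mnu] := anu i; split.
  move=> x; apply: (@continuousM R Y (fun x => 1 - w x)); last exact: cnu.
  by apply: (@continuousB R R^o Y (cst 1)); [exact: cvg_cst|exact: cw].
by apply: moves_along_le mnu => x ->; rewrite mulr0.
Qed.

(** Near [x0] all pieces of [s] lie below one level [l], and x |-> sigma (S l x) takes the same
    value at both ends of such a piece. The point mass there is mixed into [nu] with a slowly
    varying weight. [N] is fixed before [eta] and [nu], so that such corrections can be applied
    successively, each spoiling the earlier ones by at most [eta]. *)
Lemma admissible_local (s : seq I) (x0 : Y) :
  (forall i, i \in s -> eventual_domain (k i) x0) ->
  exists2 N, nbhs x0 N &
    forall eta : R, 0 < eta -> forall nu, admissible nu ->
    exists2 mu, admissible mu & forall i x y, i \in s -> piece i x y ->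
      (N x -> close eta mu x y) /\
      forall theta, 0 <= theta -> close theta nu x y -> close (theta + eta) mu x y.
Proof.
move=> sx0; have [l Dx0 sl] := common_level sx0.
have [V [sigma [oV Vx0 sigmaP]]] := S_section Dx0.
have oW : open (D l `&` S l @^-1` V).
  rewrite openE => y [Dy Vy]; apply: filterI; first exact: open_nbhs_nbhs.
  by apply: S_continuous => //; exact: open_nbhs_nbhs.
have [N x0N [cN NW]] := @locally_compact_nbhs R Y hY (@lcY) x0 _ oW (conj Dx0 Vx0).
exists N => // eta eta0 nu anu.
have Dinv i x y : i \in s -> piece i x y -> D l x -> D l y /\ S l x = S l y.
  move=> is_ [Cx Cy Sxy] Dx.
  exact: S_le (sl i is_) (C_sub Cx) (C_sub Cy) Sxy Dx.
have ND : N `<=` D l by move=> x /NW[].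
have [|w [K [[cw w01 w1] cK KD w0 winv]]] :=
    @almost_invariant_bump s (D l) N (eta / 2) (D_open l) _ cN ND (divr_gt0 eta0 (ltr0Sn R 1)).
  by move=> i x y is_ pxy /(Dinv i x y is_ pxy)[].
have cSN : compact (S l @` N).
  apply: continuous_compact => //; apply: continuous_in_subspaceT => y.
  by rewrite inE => /ND; exact: S_continuous.
have SNV : S l @` N `<=` V by move=> _ [x /NW[_ Vx] <-].
have [psi [L [cpsi psi01 psi1 [cL LV] psi0]]] :=
  @compact_bump R X hX (@lcX) V _ oV cSN SNV.
(* The second factor confines [S l x] to [V], where [sigma] is a section. It is constant along the
   pieces inside [D l], so [phi] varies no faster than [w]. *)
pose phi x := w x * psi (S l x).
have phi01 x : 0 <= phi x <= 1.
  have /andP[? ?] := w01 x; have /andP[? ?] := psi01 (S l x).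
  by rewrite /phi mulr_ge0//= mulr_ile1.
have near_phi0 x : ~ K x -> \forall z \near x, phi z = 0.
  move=> nKx; apply: (@filterS _ (nbhs x) _ (~` K)).
    by move=> z /w0; rewrite /phi => ->; rewrite mul0r.
  apply: open_nbhs_nbhs; split=> //; apply: closed_openC; exact: compact_closed.
(* [S l] is continuous on [D l], which contains [K]; near any point outside the closed set [K] the
   product is zero. *)
have cphi : continuous phi.
  move=> x; have [/KD Dx|nKx] := pselect (K x).
    apply: (@continuousM R Y w (psi \o S l)); first exact: cw.
    by apply: continuous_comp; [exact: S_continuous|exact: cpsi].
  exact: continuous_near0 (near_phi0 x nKx).
have mphi : moves_along phi (sigma \o S l).
  move=> x; have [/KD Dx|/near_phi0] := pselect (K x); last by left.
  have [Lx|nLx] := pselect (L (S l x)); last first.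
    left; apply: (@filterS _ (nbhs x) _ (S l @^-1` (~` L))).
      by move=> z /psi0; rewrite /phi => ->; rewrite mulr0.
    apply: S_continuous => //; apply: open_nbhs_nbhs; split=> //.
    by apply: closed_openC; exact: compact_closed.
  right; split.
    apply: continuous_comp; first exact: S_continuous.
    by have [] := sigmaP _ (LV _ Lx).
  exists l; apply: (@filterS _ (nbhs x) _ (D l `&` S l @^-1` V)).
    by move=> z [Dz /sigmaP[]].
  by move: oW; rewrite openE; apply; split=> //; exact: LV.
have sp : stochastic (point_kernel (R := R) (sigma \o S l)) by exact: stochastic_point.
exists (mix phi (point_kernel (sigma \o S l)) nu).
  apply: admissible_mix => // -[]; split; first by move=> x; exact: cvg_cst.
  by apply: moves_along_le mphi => x; rewrite /= mulr1.
move=> i x y is_ pxy.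
have pt (theta : R) : 0 <= theta -> phi x != 0 ->
    close theta (point_kernel (sigma \o S l)) x y.
  move=> theta0 phix t _; rewrite !ev_point/=.
  have Dx : D l x.
    apply/KD; apply: contrapT => /w0 wx0.
    by move: phix; rewrite /phi wx0 mul0r eqxx.
  by have [_ ->] := Dinv i x y is_ pxy Dx; rewrite subrr normr0.
have dphi : `|phi x - phi y| <= eta / 2.
  rewrite /phi; have [Dx|nDx] := pselect (D l x).
    have [_ ->] := Dinv i x y is_ pxy Dx.
    rewrite -mulrBl normrM; apply: (le_trans _ (winv i x y is_ pxy)).
    by rewrite ler_piMr// ger0_norm; have /andP[] := psi01 (S l y).
  have nDy : ~ D l y by move=> /(Dinv i y x is_ (piece_sym pxy))[].
  rewrite !w0 ?mul0r ?subrr ?normr0; first by rewrite divr_ge0// ltW.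
    by move=> /KD.
  by move=> /KD.
have eta2 : eta = 2 * (eta / 2) by rewrite mulrC divfK.
(* On [N] the weight is 1, so nothing is asked of [nu]; the point kernel has error 0, and the mixing
   costs 2 (eta / 2). *)
split=> [Nx|theta theta0 cnu].
  rewrite -[eta]add0r eta2; apply: close_mix => //; first by case: anu.
    exact: pt.
  by rewrite /phi w1// psi1 ?mulr1 ?eqxx//; exists x.
rewrite eta2; apply: close_mix => //; first by case: anu.
exact: pt.
Qed.

(** Compactness induction on a statement quantified over the starting kernel [nu]: for a union, the
    second correction with half the tolerance is applied to the outcome of the first. The start is
    the identity kernel. *)
Lemma admissible_compact (s : seq I) (B : set Y) (eta : R) : 0 < eta -> compact B ->
  (forall i, i \in s -> B `<=` eventual_domain (k i)) ->
  exists2 mu, admissible mu & forall i x y, i \in s -> piece i x y -> B x ->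
    close eta mu x y.
Proof.
move=> eta0 cB Bs.
pose P (A : set Y) := forall eta, 0 < eta -> forall nu, admissible nu ->
  exists2 mu, admissible mu & forall i x y, i \in s -> piece i x y ->
    (A x -> close eta mu x y) /\
    forall theta, 0 <= theta -> close theta nu x y -> close (theta + eta) mu x y.
have [||||mu amu muP] := @compact_ind Y P B cB _ _ _ _ eta eta0 _ admissible_id.
- move=> eps eps0 nu anu; exists nu => // i x y is_ pxy; split=> // theta theta0.
  by apply: close_le; rewrite lerDl ltW.
- move=> A A' PA PA' eps eps0 nu anu; have e2 : 0 < eps / 2 by rewrite divr_gt0.
  have [mu amu muP] := PA _ e2 _ anu; have [mu' amu' muP'] := PA' _ e2 _ amu.
  exists mu' => // i x y is_ pxy.
  have [c1 c2] := muP i x y is_ pxy; have [c1' c2'] := muP' i x y is_ pxy.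
  split=> [[Ax|A'x]|theta theta0 cnu].
  + by apply: close_le (c2' _ (ltW e2) (c1 Ax)); lra.
  + by apply: close_le (c1' A'x); lra.
  + have h : 0 <= theta + eps / 2 by lra.
    by apply: close_le (c2' _ h (c2 _ theta0 cnu)); lra.
- move=> A A' AA' PA' eps eps0 nu anu; have [mu amu muP] := PA' _ eps0 _ anu.
  exists mu => // i x y is_ pxy; have [c1 c2] := muP i x y is_ pxy.
  by split=> // /AA'.
- move=> x Bx.
  by have [N xN NP] := @admissible_local s x (fun i is_ => Bs i is_ x Bx); exists N.
by exists mu => // i x y is_ pxy; have [] := muP i x y is_ pxy.
Qed.

(* The pieces of [J] are treated one after the other: those of [s] are already
   available on all of [B].  Mixing with an almost invariant bump [w] around
   [C i] makes the piece [i] available wherever [w] does not vanish. *)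
Lemma admissible_pieces (J s : seq I) (B : set Y) (eta : R) : 0 < eta -> compact B ->
  (forall i, i \in s -> B `<=` eventual_domain (k i)) ->
  exists2 mu, admissible mu & forall i x y, i \in J ++ s -> piece i x y -> B x ->
    close eta mu x y.
Proof.
elim: J s B eta => [|i J IH] s B eta eta0 cB Bs; first exact: admissible_compact.
have e2 : 0 < eta / 2 by rewrite divr_gt0.
have e4 : 0 < eta / 4 by rewrite divr_gt0.
have CE : C i `<=` eventual_domain (k i) by move=> x /C_sub Dx; exists (k i).
have [w [K [[cw w01 w1] cK KE w0 winv]]] :=
  @almost_invariant_bump ((i :: J) ++ s) (eventual_domain (k i)) (C i) (eta / 4)
    (eventual_domain_open (k i)) (fun j x y _ => @eventual_domain_piece (k i) j x y)
    (C_compact (i := i)) CE e4.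
have [||mu amu muP] := IH (i :: s) (B `&` K) (eta / 2) e2.
- by apply: compact_closedI => //; exact: compact_closed.
- move=> j; rewrite inE => /predU1P[->|js] x [Bx Kx]; [exact: KE|exact: Bs].
have [nu anu nuP] := IH s B (eta / 2) e2 cB Bs.
exists (mix w mu nu).
  apply: admissible_mix => //; first by case: amu.
  have [_ {}amu] := amu => j; have [cmu mmu] := amu j; split=> //.
  by apply: moves_along_le mmu => x ->; rewrite mulr0.
move=> j x y jJs pxy Bx; have -> : eta = eta / 2 + 2 * (eta / 4) by field.
apply: close_mix => //.
- by case: amu.
- by case: anu.
- exact: winv jJs pxy.
- move=> wx0; apply: (muP j) => //.
    by move: jJs; rewrite !(mem_cat, inE) => /orP[/orP[]|] ->; rewrite ?orbT.
  by split=> //; apply: contrapT => /w0 wx; rewrite wx eqxx in wx0.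
(* Where [w] is not 1 the point lies outside [C i], so piece [i] relates it to nothing. *)
- move=> wx1; apply: (nuP j) => //; move: jJs; rewrite inE => /predU1P[ji|//].
  by move: wx1; rewrite w1 ?eqxx// -ji; case: pxy.
Qed.

Theorem approximately_invariant_kernel (s : seq I) (eta : R) : 0 < eta ->
  exists2 mu, admissible mu & forall i x y, i \in s -> piece i x y -> close eta mu x y.
Proof.
move=> eta0.
have cB : compact (\big[setU/set0]_(i <- s) C i) by exact: bigsetU_compact.
have [//|mu amu muP] := @admissible_pieces s [::] _ eta eta0 cB.
exists mu => // i x y is_ pxy; apply: (muP i) => //; first by rewrite cats0.
by rewrite -bigcup_seq; exists i => //; case: pxy.
Qed.

End System.

(** * The skew product and the groupoid *)

Section DiscreteProduct.
Context (X : topologicalType) (Q : choiceType).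
Local Notation Y := (X * discrete_topology Q)%type.

Lemma nbhs_slice (x : X) (a : Q) (A : set Y) :
  nbhs ((x, a) : Y) A <-> nbhs x [set z | A (z, a)].
Proof.
split=> [[[U V] /= [xU aV] UVA]|xA].
  by apply: filterS xU => z Uz; apply: UVA; split=> //; exact: nbhs_singleton aV.
exists ([set z | A (z, a)], [set a]) => /=.
  by split=> //; exact: discrete_set1.
by move=> [z b] /= [Az ->].
Qed.

Lemma slice_hausdorff : hausdorff_space X -> hausdorff_space Y.
Proof.
move=> hX [x a] [y b] cl.
have ab : a = b.
  have [||[z c]/= [-> ->]//] := cl [set z | z.2 = a] [set z | z.2 = b].
    by apply/nbhs_slice; exact: nearW.
  by apply/nbhs_slice; exact: nearW.
rewrite -ab in cl *; congr (_, _); apply: hX => U V xU yV.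
have [||[z c]/= [Uz Vz]] := cl [set z | U z.1] [set z | V z.1].
- exact/nbhs_slice.
- exact/nbhs_slice.
by exists z.
Qed.

Lemma slice_compact (K : set X) (a : Q) :
  compact K -> compact [set y : Y | K y.1 /\ y.2 = a].
Proof.
move=> cK; rewrite (_ : [set _ | _] = K `*` [set (a : discrete_topology Q)]) //.
exact: compact_setX cK (@compact_set1 (discrete_topology Q) a).
Qed.

Lemma slice_locally_compact : hausdorff_space X ->
  locally_compact [set: X] -> locally_compact [set: Y].
Proof.
move=> hX lcX [x a] _; have [U xU [cU _]] := @lcX x I.
rewrite withinET in xU; rewrite withinET.
have cUa := @slice_compact U a cU.
exists [set y : Y | U y.1 /\ y.2 = a].
  by apply/nbhs_slice; apply: filterS xU => z Uz; split.
by split=> //; apply: compact_closed => //; exact: slice_hausdorff.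
Qed.

End DiscreteProduct.

(** * The skew product as a directed system of levels *)

Section SkewProduct.
Context (X : topologicalType) (Q : choiceType) (mul : Q -> Q -> Q) (inv : Q -> Q) (e : Q)
        (P : set Q) (dom : X -> Q -> Prop) (act : X -> Q -> X).
Hypothesis grp : is_group mul inv e.
Hypothesis sub : subsemigroup mul e P.
Hypothesis rpa : right_partial_action mul e P dom act.
Hypothesis dir : directed_action mul P dom.
Hypothesis lca : locally_compact_action P dom act.
Local Notation Y := (X * discrete_topology Q)%type.

Definition level_dom (k : Q) : set Y := [set y | dom y.1 (mul (inv y.2) k)].
Definition level_act (k : Q) (y : Y) : X := act y.1 (mul (inv y.2) k).
(** The relation says that [l] lies in [k] P. It is invariant under left translation, hence compares
    a^-1 k with a^-1 l for all a at once. *)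
Definition level_le (k l : Q) : Prop := P (mul (inv k) l).

Lemma group_mulKV a b : mul a (mul (inv a) b) = b.
Proof. by have [mA m1 mV] := grp; rewrite mA (mV _).2 (m1 _).1. Qed.

Lemma group_mulVK a b : mul (inv a) (mul a b) = b.
Proof. by have [mA m1 mV] := grp; rewrite mA (mV _).1 (m1 _).1. Qed.

Lemma group_mulgK a b : mul (mul a b) (inv b) = a.
Proof. by have [mA m1 mV] := grp; rewrite -mA (mV _).2 (m1 _).2. Qed.

Lemma group_mulgVK a b : mul (mul a (inv b)) b = a.
Proof. by have [mA m1 mV] := grp; rewrite -mA (mV _).1 (m1 _).2. Qed.

Lemma act_continuous m x : dom x m -> {for x, continuous (act^~ m)}.
Proof.
move=> dxm; have [domP _ _] := rpa; have [_ _ _ /(_ m (domP _ _ dxm))[_ _ lh]] := lca.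
have [W [[oW Wx] _ _ + _]] := lh x dxm.
by rewrite continuous_open_subspace// => /(_ x); rewrite inE; apply.
Qed.

Lemma Udom_open m : open (Udom dom m).
Proof.
have [domP _ _] := rpa; have [Pm|nPm] := pselect (P m).
  by have [_ _ _ /(_ m Pm)[]] := lca.
rewrite (_ : Udom dom m = set0); first exact: open0.
by rewrite -subset0 => x /domP.
Qed.

(** The section inverts the local homeomorphism on [W]; its continuity is the openness of [act^~ m]
    on open subsets of [W]. *)
Lemma act_section m x : dom x m ->
  exists (V : set X) (sigma : X -> X), [/\ open V, V (act x m) &
    forall v, V v -> [/\ dom (sigma v) m, act (sigma v) m = v & {for v, continuous sigma}]].
Proof.
move=> dxm; have [domP _ _] := rpa; have [_ _ _ /(_ m (domP _ _ dxm))[_ _ lh]] := lca.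
have [W [[oW Wx] WU inj _ op]] := lh x dxm.
have /choice[sigma sigmaP] v :
    exists z, (act^~ m @` W) v -> W z /\ act z m = v.
  have [[z Wz zv]|nv] := pselect ((act^~ m @` W) v); first by exists z.
  by exists v.
exists [set act z m | z in W], sigma; split; [exact: op|by exists x|move=> v Vv].
have [Ws sv] := sigmaP v Vv; split=> //; first exact: WU.
move=> N; rewrite nbhsE => -[G [oG Gs] GN].
have oWG : open (W `&` G) by exact: openI.
apply: (@filterS _ (nbhs v) _ (act^~ m @` (W `&` G))).
  move=> _ [z [Wz Gz] <-]; apply: GN.
  have [|Wsz sz] := sigmaP (act z m); first by exists z.
  by rewrite (inj _ _ Wsz Wz sz).
apply: open_nbhs_nbhs; split; first by apply: op => // z [].
by exists (sigma v).
Qed.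

Lemma level_le_refl k : level_le k k.
Proof. by have [_ _ mV] := grp; have [Pe _] := sub; rewrite /level_le (mV k).1. Qed.

Lemma level_le_trans k l m : level_le k l -> level_le l m -> level_le k m.
Proof.
have [mA _ _] := grp; have [_ PM] := sub => kl lm.
by have := PM _ _ kl lm; rewrite -mA group_mulKV.
Qed.

Lemma level_dom_open k : open (level_dom k).
Proof.
rewrite openE => -[x a] dx; apply/nbhs_slice.
have := @Udom_open (mul (inv a) k); rewrite openE; exact.
Qed.

Lemma level_dom_cover y : exists k, level_dom k y.
Proof.
have [_ _ mV] := grp; have [_ dome _] := rpa; exists y.2.
by rewrite /level_dom/= (mV _).1; have [] := dome y.1.
Qed.

Lemma level_dom_directed k l y : level_dom k y -> level_dom l y ->
  exists r, [/\ level_le k r, level_le l r & level_dom r y].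
Proof.
case: y => x a dk dl; have [mA _ _] := grp; have [domP _ _] := rpa.
have [|r [Pr [p Pp rp] [q Pq rq] Ur]] := dir (domP _ _ dk) (domP _ _ dl).
  by exists x.
exists (mul a r); rewrite /level_le; split.
- by rewrite rp -mA group_mulKV group_mulVK.
- by rewrite rq -mA group_mulKV group_mulVK.
- rewrite /level_dom/= group_mulVK.
  have : (Udom dom (mul (inv a) k) `&` Udom dom (mul (inv a) l)) x by split.
  by rewrite Ur.
Qed.

Lemma level_act_continuous k y : level_dom k y -> {for y, continuous (level_act k)}.
Proof.
case: y => x a dx A xA; apply/nbhs_slice; exact: (act_continuous dx xA).
Qed.

(** Level [l] is level [k] followed by the action of k^-1 l, whatever the second coordinate is. *)
Lemma level_act_le k l y z : level_le k l -> level_dom k y -> level_dom k z ->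
  level_act k y = level_act k z -> level_dom l y ->
  level_dom l z /\ level_act l y = level_act l z.
Proof.
case: y z => [x a] [y b]; rewrite /level_dom /level_act /level_le /= => kl dxk dyk xy dxl.
have [mA _ _] := grp; have [domP _ axm] := rpa.
have E c : mul (inv c) l = mul (mul (inv c) k) (mul (inv k) l) by rewrite -mA group_mulKV.
have [axx exx] := axm x _ _ (domP _ _ dxk) kl; have [ayy eyy] := axm y _ _ (domP _ _ dyk) kl.
rewrite (E a) in dxl *; rewrite (E b).
have [_ dkl] := axx.1 dxl.
have dyl : dom y (mul (mul (inv b) k) (mul (inv k) l)) by apply/ayy; rewrite -xy.
by split=> //; rewrite -exx// -eyy// xy.
Qed.

Lemma level_act_section k y : level_dom k y ->
  exists (V : set X) (sigma : X -> Y), [/\ open V, V (level_act k y) &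
    forall v, V v -> [/\ level_dom k (sigma v), level_act k (sigma v) = v &
                        {for v, continuous sigma}]].
Proof.
case: y => x a dx; have [V [sigma [oV Vx sV]]] := act_section dx.
exists V, (fun v => (sigma v, a)); split=> // v Vv.
have [ds as_ cs] := sV v Vv; split=> // A /nbhs_slice; exact: cs.
Qed.

Lemma skew_kernel (R : realType) (I : choiceType) (k : I -> Q) (C : I -> set Y)
    (s : seq I) (eta : R) :
  (forall i, compact (C i)) -> (forall i, C i `<=` level_dom (k i)) -> 0 < eta ->
  exists2 mu : kernel R Y, admissible level_dom level_act mu &
    forall i x y, i \in s -> piece level_act k C i x y -> close eta mu x y.
Proof.
move=> cC CD eta0; have [hX lcX _ _] := lca.
apply: (approximately_invariant_kernel hX lcX (slice_hausdorff hX)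
  (slice_locally_compact hX lcX) (ple := level_le) (D := level_dom) (S := level_act)) => //.
- exact: level_le_refl.
- exact: level_le_trans.
- exact: level_dom_open.
- exact: level_dom_cover.
- exact: level_dom_directed.
- exact: level_act_continuous.
- exact: level_act_le.
- exact: level_act_section.
Qed.

Local Notation Gset := (Gset mul inv P dom act).
Local Notation Gopen := (Gopen mul inv P dom act).
Local Notation fiber := (fiber mul inv P dom act).

Lemma level_cocycle l a b :
  mul (inv a) b = mul (mul (inv a) l) (inv (mul (inv b) l)).
Proof.
have [mA _ _] := grp.
by rewrite (group_inv_mul grp) (group_inv_inv grp) mA group_mulgK.
Qed.

Lemma level_Gset l x a z b :
  level_dom l (x, a) -> level_dom l (z, b) -> level_act l (x, a) = level_act l (z, b) ->
  Gset (x, mul (inv a) b, z).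
Proof.
move=> dx dz xz; have [domP _ _] := rpa; have [mA _ _] := grp.
exists (mul (inv a) l), (mul (inv b) l); split=> //=.
- by split; apply: domP; [exact: dx|exact: dz].
- exact: level_cocycle.
Qed.

(* The pairs (m, n) and (m1, n1) presenting the same q are compared after acting
   by a further p with m p = m1 p1, and act^~ p1 is locally injective. *)
Lemma Gopen_near (A : set (X * Q * X)) x0 q (tau : X -> X) m n :
  Gopen A -> A (x0, q, tau x0) -> {for x0, continuous tau} ->
  P m -> P n -> q = mul m (inv n) ->
  (\forall x \near x0, [/\ dom x m, dom (tau x) n & act x m = act (tau x) n]) ->
  \forall x \near x0, A (x, q, tau x).
Proof.
move=> oA Ax ctau Pm Pn qmn near_mn.
have [domP _ axm] := rpa; have [mA _ _] := grp.
have [U [m1 [n1 [V [[oU oV] Pm1 Pn1 /= [/= qmn1 [Ux Vx] dm1 dn1 xm1] ZA]]]]] := oA _ Ax.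
have [dm dn xm] := nbhs_singleton near_mn.
have [|r [Pr [p Pp rp] [p1 Pp1 rp1] Ur]] := dir Pm Pm1; first by exists x0.
have dr : dom x0 r.
  have : (Udom dom m `&` Udom dom m1) x0 by split.
  by rewrite Ur.
(* Both n and n1 are recovered from q as q^-1 m and q^-1 m1, and m p = m1 p1. *)
have np : mul n p = mul n1 p1.
  have q_m a b : q = mul a (inv b) -> b = mul (inv q) a.
    by move=> ->; rewrite (group_inv_mul grp) (group_inv_inv grp) group_mulgVK.
  rewrite (q_m _ _ qmn) (q_m _ _ qmn1).
  by rewrite -!mA -rp -rp1.
have dv : dom (act x0 m1) p1.
  by rewrite rp1 in dr; have [axx _] := axm x0 _ _ Pm1 Pp1; have [] := axx.1 dr.
have [_ _ _ /(_ p1 Pp1)[_ _ lh]] := lca.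
have [W [[oW Wv] _ inj _ _]] := lh _ dv.
have near_m1 : \forall x \near x0, dom x m1 by have := Udom_open m1; rewrite openE; exact.
have near_n1 : \forall x \near x0, dom (tau x) n1.
  exact: (ctau _ (open_nbhs_nbhs (conj (Udom_open n1) dn1))).
have near_r : \forall x \near x0, dom x r by have := Udom_open r; rewrite openE; exact.
have near_U : \forall x \near x0, U x by apply: open_nbhs_nbhs.
have near_V : \forall x \near x0, V (tau x).
  exact: (ctau _ (open_nbhs_nbhs (conj oV Vx))).
have near_W : \forall x \near x0, W (act x m1).
  exact: (act_continuous dm1 (open_nbhs_nbhs (conj oW Wv))).
have near_W' : \forall x \near x0, W (act (tau x) n1).
  have c : {for x0, continuous (act^~ n1 \o tau)}.
    by apply: continuous_comp => //; exact: act_continuous.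
  by apply: (c W); apply: open_nbhs_nbhs; split=> //=; rewrite -xm1.
near=> x; apply: ZA; split=> //=; [split| | |].
- by near: x.
- by near: x.
- by near: x.
- by near: x.
have dxr : dom x r by near: x.
have dxm1 : dom x m1 by near: x.
have dxn1 : dom (tau x) n1 by near: x.
have [dxm dxn exm] : [/\ dom x m, dom (tau x) n & act x m = act (tau x) n] by near: x.
apply: inj; [by near: x|by near: x|].
have [a1 e1] := axm x _ _ Pm1 Pp1; have [a2 e2] := axm x _ _ Pm Pp.
have [a3 e3] := axm (tau x) _ _ Pn Pp; have [a4 e4] := axm (tau x) _ _ Pn1 Pp1.
have dxmp : dom (act x m) p by rewrite rp in dxr; have [] := a2.1 dxr.
have dnp : dom (tau x) (mul n p) by apply/a3; split=> //; rewrite -exm.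
rewrite e1 -?rp1// rp -e2 -?rp// exm e3// np e4// -np//.
Unshelve. all: by end_near. Qed.

Lemma Gset_inv (g : X * Q * X) : Gset g -> Gset (Ginv inv g).
Proof.
case: g => [[x q] y] [m [n [[Pm Pn] /= -> dm dn xy]]].
by exists n, m; split=> //=; rewrite (group_inv_mul grp) (group_inv_inv grp).
Qed.

(** Directedness at the middle point [y] gives r = n p = m' p', and both presentations, extended by
    [p] and [p'], meet at y.r. *)
Lemma Gset_mul (g h : X * Q * X) : Gset g -> Gset h -> g.2 = h.1.1 -> Gset (Gmul mul g h).
Proof.
case: g h => [[x q] y] [[y' q'] z] [m [n [[Pm Pn] /= -> dm dn xy]]].
move=> [m' [n' [[Pm' Pn'] /= -> dm' dn' yz]]] yy'; rewrite -{y'}yy' in dm' yz *.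
have [domP _ axm] := rpa; have [mA m1 mV] := grp; have [_ PM] := sub.
have [|r [Pr [p Pp rp] [p' Pp' rp'] Ur]] := dir Pn Pm'; first by exists y.
have dr : dom y r.
  have : (Udom dom n `&` Udom dom m') y by split.
  by rewrite Ur.
have [a1 e1] := axm y _ _ Pn Pp; have [a2 e2] := axm y _ _ Pm' Pp'.
have [a3 e3] := axm x _ _ Pm Pp; have [a4 e4] := axm z _ _ Pn' Pp'.
have dnp : dom (act y n) p by rewrite rp in dr; have [] := a1.1 dr.
have dmp' : dom (act y m') p' by rewrite rp' in dr; have [] := a2.1 dr.
have dxmp : dom x (mul m p) by apply/a3; rewrite xy.
have dznp : dom z (mul n' p') by apply/a4; rewrite -yz.
exists (mul m p), (mul n' p'); split=> //=.
- by split; exact: PM.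
- have E : mul (inv n) m' = mul p (inv p').
    apply: (@group_mulI _ mul inv e grp n); rewrite group_mulKV.
    by rewrite mA -rp rp' group_mulgK.
  by rewrite (group_inv_mul grp) -!mA (mA _ m') E -mA.
- by rewrite -e3// xy e1 -?rp// rp' -e2 -?rp'// yz e4.
Qed.

Lemma Gmul_VK (g h : X * Q * X) : Gmul mul (Ginv inv g) (Gmul mul g h) = (g.2, h.1.2, h.2).
Proof. by rewrite /Gmul /Ginv/= group_mulVK. Qed.

Lemma Gmul_KV (g h : X * Q * X) : Gmul mul g (Gmul mul (Ginv inv g) h) = (g.1.1, h.1.2, h.2).
Proof. by rewrite /Gmul /Ginv/= group_mulKV. Qed.

Lemma translate_sum_diff (R : realType) (F : {fset Q}) q (v : Q -> R) :
  (forall b, `|v b| <= 1) ->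
  `|\sum_(a <- F) v (mul a (inv q)) - \sum_(b <- F) v b| <=
    2 * #|` [fset b in F | mul b q \notin F]%fset|%:R.
Proof.
move=> v1; have [mA m1 mV] := grp.
pose G := [fset mul a (inv q) | a in F]%fset.
have inj : injective (mul^~ (inv q)).
  by move=> a b /(congr1 (mul^~ q)); rewrite !group_mulgVK.
have mem_G b : (b \in G) = (mul b q \in F).
  apply/imfsetP/idP => [[a aF ->]|bqF]; first by rewrite group_mulgVK.
  by exists (mul b q) => //; rewrite group_mulgK.
have split_sum (u : Q -> R) :
    \sum_(a <- F) u (mul a (inv q)) - \sum_(b <- F) u b =
    \sum_(b <- G | b \notin F) u b - \sum_(b <- F | b \notin G) u b.
  have -> : \sum_(a <- F) u (mul a (inv q)) = \sum_(b <- G) u b.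
    by rewrite big_imfset//= => a b _ _; exact: inj.
  rewrite (bigID [in F])/= [\sum_(b <- F) _](bigID [in G])/=.
  have -> : \sum_(b <- G | b \in F) u b = \sum_(b <- F | b \in G) u b.
    rewrite -[LHS]big_filter -[RHS]big_filter; apply: perm_big.
    apply: uniq_perm; rewrite ?filter_uniq ?fset_uniq// => b.
    by rewrite !mem_filter andbC.
  by ring.
have card_diff :
    \sum_(b <- F | b \notin G) 1 = #|` [fset b in F | mul b q \notin F]%fset|%:R :> R.
  rewrite -big_filter big_const_seq count_predT iter_addr_0; congr (_%:R).
  apply: perm_size; apply: uniq_perm; rewrite ?filter_uniq ?fset_uniq// => b.
  by rewrite mem_filter !inE mem_G andbC.
(* Applied to the constant 1, [split_sum] has left side 0, so the two set differences have the same
   size. *)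
have card_diff' : \sum_(b <- G | b \notin F) 1 = \sum_(b <- F | b \notin G) 1 :> R.
  by have := split_sum (fun=> 1); rewrite subrr => /esym/eqP; rewrite subr_eq0 => /eqP.
rewrite split_sum -card_diff mulr_natl mulr2n -{1}card_diff'.
apply: (le_trans (ler_normB _ _)).
by apply: lerD; apply: (le_trans (ler_norm_sum _ _ _)); apply: ler_sum => b _.
Qed.

(** * Averaging a kernel over a finite subset of the group *)

Section Average.
Context {R : realType} (F : {fset Q}) (mu : kernel R Y).
Hypothesis amu : admissible level_dom level_act mu.

Definition average_pairing (x : X) (h : X * Q * X -> R) : R :=
  #|` F|%:R^-1 * \sum_(a <- F) ev mu (x, a) (fun w => h (x, mul (inv a) w.2, w.1)).

(** The density of the mean paired in [average_pairing]: the point mass at w = (z, b) seen from (x,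
    a) is carried to the arrow (x, a^-1 b, z). *)
Definition average_density (g : X * Q * X) : R :=
  #|` F|%:R^-1 *
    \sum_(a <- F) ev mu (g.1.1, a) (fun w => (w == (g.2, mul a g.1.2))%:R).

Lemma target_fiber i x a : @wt _ _ mu i (x, a) != 0 ->
  fiber x (x, mul (inv a) (@tg _ _ mu i (x, a)).2, (@tg _ _ mu i (x, a)).1).
Proof.
move=> wn0; split=> //; have [_ /(_ i)[_ /(_ (x, a))]] := amu.
case=> [/nbhs_singleton w0|[_ [l /nbhs_singleton[dx dt xt]]]].
  by rewrite w0 eqxx in wn0.
by move: dt xt; case: (tg _) => z b dt xt; exact: level_Gset dx dt xt.
Qed.

Lemma average_density_ge0 g : 0 <= average_density g.
Proof.
have [[w0 _] _] := amu.
apply: mulr_ge0; first by rewrite invr_ge0.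
by apply: sumr_ge0 => a _; apply: sumr_ge0 => i _; rewrite mulr_ge0.
Qed.

Lemma fiber_esum_average x (h : X * Q * X -> R) : (forall g, 0 <= h g) ->
  (\esum_(g in fiber x) (average_density g * h g)%:E = (average_pairing x h)%:E)%E.
Proof.
move=> h0; have [[w0 _] _] := amu.
pose c : R := #|` F|%:R^-1.
have c0 : 0 <= c by rewrite invr_ge0.
pose term a i (g : X * Q * X) : R :=
  c * (@wt _ _ mu i (x, a) *
       (@tg _ _ mu i (x, a) == (g.2, mul a g.1.2))%:R * h g).
have term0 a i g : 0 <= term a i g by rewrite /term !mulr_ge0.
rewrite (eq_esum (b := fun g =>
    \sum_(a <- F) \sum_(i : ix mu) (term a i g)%:E)%E); last first.
  move=> g [_ gx]; rewrite /range_map in gx.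
  under eq_bigr do rewrite sumEFin.
  rewrite sumEFin; congr EFin; rewrite /average_density -/c gx -mulrA mulr_suml mulr_sumr.
  by apply: eq_bigr => a _; rewrite /ev mulr_suml mulr_sumr.
rewrite esum_sum; last by move=> g a _ _; apply: sume_ge0 => i _; rewrite lee_fin.
rewrite /average_pairing mulr_sumr -sumEFin; apply: eq_bigr => a _.
rewrite esum_sum; last by move=> g i _ _; rewrite lee_fin.
rewrite /ev mulr_sumr -sumEFin; apply: eq_bigr => i _.
set w := tg _ _.
have [wz|wn0] := eqVneq (@wt _ _ mu i (x, a)) 0.
  rewrite wz mul0r mulr0 esum1// => g _.
  by rewrite /term wz !mul0r mulr0.
(* A point mass of nonzero weight meets exactly one arrow of the fibre. *)
rewrite (esum_single (t0 := (x, mul (inv a) w.2, w.1))).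
- by rewrite /term /= group_mulKV -/w -surjective_pairing eqxx mulr1.
- exact: target_fiber.
- by rewrite lee_fin.
- move=> [[x1 q] z] [_ xx]; rewrite /range_map/= in xx; rewrite xx /term /= -/w.
  case: eqP => [-> /=|_ _]; first by rewrite group_mulVK.
  by rewrite !(mulr0, mul0r).
Qed.

(* The hypothesis on [f] is [Gcontinuous] for a general real type. *)
Lemma average_pairing_continuous (f : X * Q * X -> R) :
  (forall W : set R, open W -> Gopen [set g | Gset g /\ W (f g)]) ->
  continuous (average_pairing^~ f).
Proof.
move=> cf x0; apply: (@continuousM R X (cst _)); first exact: cvg_cst.
apply: continuous_sum => a {}x0.
apply: continuous_sum => i {}x0.
have [_ /(_ i)[cw /(_ (x0, a)) mw]] := amu.
have cslice : {for x0, continuous (fun x : X => (x, a) : Y)}.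
  by move=> A /nbhs_slice.
case: mw => [w0|[ct [l near_l]]].
  apply: continuous_near0; have /nbhs_slice := w0.
  by apply: filterS => x /= ->; rewrite mul0r.
apply: (@continuousM R X (fun x => @wt _ _ mu i (x, a))).
  by move=> A /(cw (x0, a)) /nbhs_slice.
set tau := @tg _ _ mu i in ct near_l *.
have [dx0 dt0 xt0] := nbhs_singleton near_l.
have [domP _ _] := rpa; have [mA _ _] := grp.
pose b0 := (tau (x0, a)).2.
(* As [Q] is discrete, the second coordinate of a continuous target is locally constant; the arrows
   then have a fixed group component and [Gopen_near] applies. *)
have near_b : \forall x \near x0, (tau (x, a)).2 = b0.
  have nb : nbhs (tau (x0, a)) [set w : Y | w.2 = b0].
    by rewrite [tau _]surjective_pairing; apply/nbhs_slice; exact: nearW.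
  by have /nbhs_slice := ct _ nb.
have cz : {for x0, continuous (fun x => (tau (x, a)).1)}.
  move=> A zA.
  have nA : nbhs (tau (x0, a)) [set w : Y | A w.1].
    by rewrite [tau _]surjective_pairing; apply/nbhs_slice.
  by have /nbhs_slice := ct _ nA.
move=> A; rewrite nbhsE => -[W [oW Wf] WA].
have G0 : Gset (x0, mul (inv a) b0, (tau (x0, a)).1).
  by move: dt0 xt0; rewrite /b0; case: (tau _) => z b; exact: level_Gset.
have near_x : \forall x \near x0, [/\ dom x (mul (inv a) l),
    dom (tau (x, a)).1 (mul (inv b0) l) &
    act x (mul (inv a) l) = act (tau (x, a)).1 (mul (inv b0) l)].
  have /nbhs_slice near_l' := near_l.
  apply: filterS2 near_l' near_b => x [/= dx dt xt] <-.
  by split.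
have [dx1 dz1 _] := nbhs_singleton near_x.
have near_G := Gopen_near (cf W oW) (conj G0 Wf) cz
  (domP _ _ dx1) (domP _ _ dz1) (level_cocycle l a b0) near_x.
by apply: filterS2 near_G near_b => x [_ Wfx] bx; apply: WA; rewrite bx.
Qed.

Lemma average_pairingB x f h :
  average_pairing x f - average_pairing x h = average_pairing x (f \- h).
Proof.
rewrite /average_pairing -mulrBr -sumrB; congr (_ * _).
apply: eq_bigr => a _; rewrite /ev -sumrB.
by apply: eq_bigr => i _; rewrite -mulrBr.
Qed.

Lemma average_pairing1 x : F != fset0 -> average_pairing x (cst 1) = 1.
Proof.
move=> F0; have [[_ w1] _] := amu; rewrite /average_pairing.
rewrite (eq_bigr (fun=> 1)); last first.
  move=> a _; rewrite -[RHS](w1 (x, a)); apply: eq_bigr => i _.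
  by rewrite /= mulr1.
rewrite big_const_seq count_predT iter_addr_0 mulVf//.
by rewrite pnatr_eq0 cardfs_eq0.
Qed.

(** Left multiplication by [g] maps the fibre over the source of [g] bijectively onto the fibre over
    its range. *)
Lemma fiber_esum_translate g (h : X * Q * X -> R) : Gset g -> (forall k, 0 <= h k) ->
  (\esum_(k in fiber (range_map g)) (average_density (Gmul mul (Ginv inv g) k) * h k)%:E =
   (average_pairing g.2 (fun k => h (Gmul mul g k)))%:E)%E.
Proof.
move=> Gg h0; rewrite -fiber_esum_average//.
rewrite (reindex_esum (fiber g.2) _ (Gmul mul g)).
  apply: eq_esum => k [_ ky]; rewrite /range_map in ky; rewrite Gmul_VK -ky.
  by case: k {ky} => [[? ?] ?].
split.
- by move=> k [Gk ky]; split=> //; exact: Gset_mul.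
- move=> [[x1 q1] z1] [[x2 q2] z2]; rewrite !inE => -[_ /= x1y] [_ /= x2y] [].
  rewrite /range_map/= in x1y x2y; rewrite x1y x2y.
  by move=> /(group_mulI grp) -> ->.
- move=> k [Gk kx]; exists (Gmul mul (Ginv inv g) k).
    by split=> //; apply: Gset_mul => //; exact: Gset_inv.
  by move: kx; rewrite Gmul_KV /range_map => <-; case: k {Gk} => [[? ?] ?].
Qed.

(* The l^1-distance is attained by pairing with the sign of the difference. *)
Lemma fiber_l1_dual g : Gset g -> exists t : X * Q * X -> R,
  (forall k, `|t k| <= 1) /\
  (\esum_(k in fiber (range_map g))
     (`|average_density (Gmul mul (Ginv inv g) k) - average_density k|)%:E =
   (average_pairing g.2 (fun k => t (Gmul mul g k)) - average_pairing g.1.1 t)%:E)%E.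
Proof.
move=> Gg.
pose a k := average_density (Gmul mul (Ginv inv g) k); pose b k := average_density k.
pose tp k : R := (b k <= a k)%R%:R; pose tm k : R := (a k < b k)%R%:R.
have tp0 k : 0 <= tp k by rewrite ler0n.
have tm0 k : 0 <= tm k by rewrite ler0n.
have a0 k : 0 <= a k by exact: average_density_ge0.
have b0 k : 0 <= b k by exact: average_density_ge0.
exists (tp \- tm); split=> [k|].
  by rewrite /= /tp /tm; case: leP => _; rewrite ?subr0 ?sub0r ?normrN normr1.
have sumE (u v : X * Q * X -> R) : (forall k, 0 <= u k) -> (forall k, 0 <= v k) ->
  (\esum_(k in fiber (range_map g)) (a k * u k + b k * v k)%:E =
   (average_pairing g.2 (fun k => u (Gmul mul g k)) + average_pairing g.1.1 v)%:E)%E.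
  move=> u0 v0; under eq_esum do rewrite EFinD.
  rewrite esumD; [|by move=> k _; rewrite lee_fin mulr_ge0..].
  by rewrite fiber_esum_translate// fiber_esum_average.
(* The identity is arranged without subtraction, since the sums are extended reals; two of them are
   finite pairings, which makes the third finite. *)
have : (\esum_(k in fiber (range_map g)) (`|a k - b k|)%:E +
    \esum_(k in fiber (range_map g)) (a k * tm k + b k * tp k)%:E =
    \esum_(k in fiber (range_map g)) (a k * tp k + b k * tm k)%:E)%E.
  rewrite -esumD; last 2 first.
  - by move=> k _; rewrite lee_fin.
  - by move=> k _; rewrite lee_fin addr_ge0// mulr_ge0.
  apply: eq_esum => k _; rewrite -EFinD; congr EFin.
  rewrite /tp /tm; case: leP => ab.
    by rewrite ger0_norm ?subr_ge0// !mulr1 !mulr0; ring.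
  by rewrite ltr0_norm ?subr_lt0// !mulr1 !mulr0; ring.
rewrite !sumE//; case: (\esum_(k in _) _) => [r| |] //= -[rE]; congr EFin.
transitivity ((average_pairing g.2 (fun k => tp (Gmul mul g k))
    - average_pairing g.2 (fun k => tm (Gmul mul g k)))
  - (average_pairing g.1.1 tp - average_pairing g.1.1 tm));
  last by rewrite !average_pairingB.
by move: rE; lra.
Qed.

(** With a = b q the translated pairing at [g.2] tests mu at (y, b q) against the function that
    tests mu at (x, b). Closeness of these points costs [eta]; replacing the range F q^-1 of b by
    [F] costs twice the Folner defect. *)
Lemma average_pairing_close g (eta eps : R) (t : X * Q * X -> R) : F != fset0 ->
  (forall b, b \in F -> close eta mu (g.1.1, b) (g.2, mul b g.1.2)) ->
  #|` [fset b in F | mul b g.1.2 \notin F]%fset|%:R <= eps * #|` F|%:R ->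
  (forall k, `|t k| <= 1) ->
  average_pairing g.2 (fun k => t (Gmul mul g k)) - average_pairing g.1.1 t <= eta + 2 * eps.
Proof.
case: g => [[x q] y] /= F0 mu_close folner t1; have [mA _ _] := grp; have [smu _] := amu.
pose tb b (w : Y) := t (x, mul (inv b) w.2, w.1).
pose v b := ev mu (y, mul b q) (tb b); pose u b := ev mu (x, b) (tb b).
have v1 b : `|v b| <= 1 by apply: ev_bound => // w; exact: t1.
have FR : 0 < #|` F|%:R :> R by rewrite ltr0n cardfs_gt0.
have -> : average_pairing y (fun k => t (Gmul mul (x, q, y) k)) =
    #|` F|%:R^-1 * \sum_(a <- F) v (mul a (inv q)).
  congr (_ * _); apply: eq_bigr => a _; rewrite /v group_mulgVK; congr (ev _ _ _).
  apply/funext => w; rewrite /tb /Gmul/=.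
  by rewrite (group_inv_mul grp) (group_inv_inv grp) mA.
rewrite /average_pairing -/u -mulrBr mulrC ler_pdivrMr//.
have := translate_sum_diff F q v1.
have : \sum_(b <- F) v b - \sum_(b <- F) u b <= eta * #|` F|%:R.
  have -> : eta * #|` F|%:R = \sum_(b <- F) eta.
    by rewrite big_const_seq count_predT iter_addr_0 mulr_natr.
  rewrite -sumrB.
  rewrite !big_seq; apply: ler_sum => b bF.
  have := mu_close b bF (tb b) (fun w => t1 _).
  by rewrite ler_norml => /andP[+ _]; rewrite /u /v; lra.
rewrite ler_norml => vu /andP[_ vv].
by move: folner vu vv; rewrite /u; lra.
Qed.

End Average.

(** * Compact sets of arrows and the approximate invariant mean *)

Local Notation Gcompact := (Gcompact mul inv P dom act).
Local Notation Zbasic := (Zbasic mul inv dom act).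

Lemma compact_box g : exists d : (Q * Q) * (set X * set X),
  [/\ P d.1.1 /\ P d.1.2, compact d.2.1 /\ compact d.2.2,
      d.2.1 `<=` Udom dom d.1.1, d.2.2 `<=` Udom dom d.1.2 &
      Gset g -> Zbasic d.2.1° d.1.1 d.1.2 d.2.2° g].
Proof.
have [[m [n [[Pm Pn] qmn dm dn xy]]]|nG] := pselect (Gset g); last first.
  (* Empty boxes serve as default outside the groupoid, so that [choice] applies to all triples. *)
  have [Pe _] := sub; exists ((e, e), (set0, set0)).
  by split=> //; split; exact: compact0.
have [hX lcX _ _] := lca.
have [A xA [cA AU]] := @locally_compact_nbhs R X hX lcX _ _ (Udom_open m) dm.
have [B yB [cB BU]] := @locally_compact_nbhs R X hX lcX _ _ (Udom_open n) dn.
by exists ((m, n), (A, B)); split=> // _; split.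
Qed.

Lemma max_sub_maxN (K : realDomainType) (r : K) :
  Num.max r 0 - Num.max (- r) 0 = r.
Proof.
have [r0|r0] := leP r 0.
  by rewrite max_l ?oppr_ge0// sub0r opprK.
by rewrite max_r ?oppr_le0 ?ltW// subr0.
Qed.

Lemma approximate_mean (K : set (X * Q * X)) (eps : R) :
  amenable_group mul -> Gcompact K -> 0 < eps ->
  exists m : X * Q * X -> R,
  [/\ forall g, 0 <= m g,
      forall x, (\esum_(g in fiber x) (m g)%:E = 1)%E,
      (forall f, Gcc mul inv P dom act f ->
         {within [set: X], continuous
           (fun x => fiber_sum mul inv P dom act x (fun g => m g * f g))}) &
      (forall g, K g ->
         (\esum_(h in fiber (range_map g))
            (`|m (Gmul mul (Ginv inv g) h) - m h|)%:E < eps%:E)%E)].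
Proof.
move=> am [KG Kcompact] eps0; have [hX _ _ _] := lca; have [mA _ _] := grp.
have [d dP] := choice compact_box.
pose m g := (d g).1.1; pose n g := (d g).1.2; pose q g := mul (m g) (inv (n g)).
pose O g := Zbasic (d g).2.1° (m g) (n g) (d g).2.2°.
have [g|g Kg|J0 finJ0 KJ0] := Kcompact _ O.
- move=> h Oh; exists (d g).2.1°, (m g), (n g), (d g).2.2°.
  have [[Pm Pn] _ _ _ _] := dP g.
  by split=> //; split; exact: open_interior.
- by exists g => //; have [_ _ _ _] := dP g; apply; exact: KG.
pose J : {fset X * Q * X} := fset_set J0.
(* The same tolerance serves the kernel and the Folner set; the total error is eps/4 + 2 (eps/4) <
   eps. *)
have e4 : 0 < eps / 4 by rewrite divr_gt0.
have [F F0 folner] := amenable_folner grp [fset q g | g in J]%fset am e4.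
(* For an arrow (x, q, y) in the box of g' and b in [F], level b m identifies (x, b) with (y, b q),
   because it acts on x by m and on y by n. [C] contains both points, so the pair belongs to piece
   (b, g'). *)
pose k (i : Q * (X * Q * X)) := mul i.1 (m i.2).
pose C (i : Q * (X * Q * X)) : set Y :=
  [set y | (d i.2).2.1 y.1 /\ y.2 = i.1] `|`
  [set y | (d i.2).2.2 y.1 /\ y.2 = mul i.1 (q i.2)].
have level_n b g : mul (inv (mul b (q g))) (mul b (m g)) = n g.
  rewrite (group_inv_mul grp) -mA group_mulVK /q (group_inv_mul grp) (group_inv_inv grp).
  by rewrite group_mulgVK.
have [i|[b g] [x a]|//|mu amu muP] :=
    @skew_kernel R (Q * (X * Q * X))%type k C [seq (b, g) | b <- F, g <- J] (eps / 4).
- have [_ [cA cB] _ _ _] := dP i.2.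
  by apply: compactU; exact: slice_compact.
- have [_ _ AU BU _] := dP g.
  rewrite /level_dom /k/= => -[[/= /AU dx ->]|[/= /BU dx ->]].
    by rewrite group_mulVK.
  by rewrite level_n.
pose M := average_density F mu.
have M0 g : 0 <= M g by exact: average_density_ge0.
exists M; split=> //.
- move=> x; have := fiber_esum_average F amu x (fun=> ler01).
  rewrite average_pairing1// => <-; apply: eq_esum => g _.
  by rewrite mulr1.
- move=> f [cf _]; apply: continuous_subspaceT.
  rewrite (_ : (fun _ => _) = average_pairing F mu ^~ f).
    exact: average_pairing_continuous.
  apply/funext => x; rewrite /fiber_sum.
  have part (h : X * Q * X -> R) :
      (\esum_(g in fiber x) (Num.max (M g * h g) 0)%:E =
       (average_pairing F mu x (fun g => Num.max (h g) 0))%:E)%E.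
    rewrite -fiber_esum_average//; last by move=> g; rewrite le_max lexx orbT.
    by apply: eq_esum => g _; rewrite maxr_pMr// mulr0.
  rewrite part.
  rewrite (eq_esum (b := fun g => (Num.max (M g * - f g) 0)%:E)); last first.
    by move=> g _; rewrite mulrN.
  rewrite (part (fun g => - f g))/= average_pairingB; congr average_pairing.
  apply/funext => g /=.
  exact: max_sub_maxN.
- move=> g Kg; have [t [t1 ->]] := fiber_l1_dual F amu (KG g Kg).
  have [g' J0g' [qg [Ag Bg] dm dn xy]] := KJ0 g Kg.
  have g'J : g' \in J by rewrite in_fset_set// inE.
  rewrite lte_fin; apply: (@le_lt_trans _ _ (eps / 4 + 2 * (eps / 4))); last by lra.
  apply: average_pairing_close => //.
    move=> b bF; apply: (muP (b, g')); first exact: allpairs_f.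
    split.
    + by left; split=> //; exact: interior_subset.
    + by right; split=> /=; [exact: interior_subset|rewrite qg].
    + by rewrite /level_act/= /k/= group_mulVK qg level_n.
  apply: folner; rewrite qg; apply/imfsetP; exists g' => //.
Qed.

Lemma skew_product_amenable : amenable_group mul ->
  topologically_amenable mul inv P dom act.
Proof.
move=> am.
(* The net is indexed by a compact set and a tolerance; later indices have larger sets and smaller
   tolerances. *)
pose I := {p : set (X * Q * X) * R | Gcompact p.1 /\ 0 < p.2}.
pose le (i j : I) := (sval i).1 `<=` (sval j).1 /\ (sval j).2 <= (sval i).2.
have [m mP] := choice (fun i : I => approximate_mean am (proj2_sig i).1 (proj2_sig i).2).
have Gcompact0 : Gcompact set0.
  split=> // J O _ _; exists set0 => //.
have GcompactU K L : Gcompact K -> Gcompact L -> Gcompact (K `|` L).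
  move=> [KG cK] [LG cL]; split=> [g [/KG|/LG]//|J O oO KLO].
  have [|S finS KS] := cK J O oO; first by move=> g Kg; apply: KLO; left.
  have [|T finT LT] := cL J O oO; first by move=> g Lg; apply: KLO; right.
  exists (S `|` T); first by rewrite finite_setU.
  by move=> g [/KS|/LT] [j jS Oj]; exists j => //; [left|right].
exists I, le, m; split.
- split; last by move=> i; split.
  by exists (exist _ (set0, 1) (conj Gcompact0 ltr01)).
- split.
    move=> i j k [ij ji] [jk kj]; split; first exact: subset_trans jk.
    exact: le_trans kj ji.
  move=> [[K a] [cK /= a0]] [[L b] [cL /= b0]].
  have ab0 : 0 < Num.min a b by rewrite lt_min a0 b0.
  exists (exist _ (K `|` L, Num.min a b) (conj (GcompactU _ _ cK cL) ab0)).
  split; split=> /=.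
  + by move=> g; left.
  + by rewrite ge_min lexx.
  + by move=> g; right.
  + by rewrite ge_min lexx orbT.
- by split=> [i g _|i x]; have [] := mP i.
- by move=> i; have [] := mP i.
- move=> K cK eps eps0; exists (exist _ (K, eps) (conj cK eps0)).
  move=> i [/= Ki epsi] g Kg; have [_ _ _ h] := mP i.
  by apply: (lt_le_trans (h g (Ki g Kg))); rewrite lee_fin.
Qed.
End SkewProduct.

Theorem theorem5p13 (Q : choiceType) (mul : Q -> Q -> Q) (inv : Q -> Q) (e : Q)
  (P : set Q) (X : topologicalType) (dom : X -> Q -> Prop) (act : X -> Q -> X) :
  is_group mul inv e ->
  countable [set: Q] ->
  amenable_group mul ->
  subsemigroup mul e P ->
  right_partial_action mul e P dom act ->
  directed_action mul P dom ->
  locally_compact_action P dom act ->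
  topologically_amenable mul inv P dom act.
Proof.
move=> grp _ am sub rpa dir lca.
exact: skew_product_amenable grp sub rpa dir lca am.
Qed.
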